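(* Let $N,n\in\mathbb N$ and write $n=\nu N$. Let $z_k=\cos\frac{k\pi}n\in[-1,1]$, $k=0,\dots,n$, be the Chebyshev points, let $$w_k=\frac1n\,\varepsilon_n(k)^2\sum_{j=0}^{\lfloor n/2\rfloor}\varepsilon_n(2j)^2\,\frac2{1-4j^2}\cos\frac{2jk\pi}n,\qquad k=0,\dots,n,$$ where $\varepsilon_n(0)=\varepsilon_n(n)=\frac{\sqrt2}2$ and $\varepsilon_n(j)=1$ for $j=1,\dots,n-1$, and set $C=\frac{\pi(\mathrm e^2-1)}{2\mathrm e}$. Then for all $x\in[-1,1]$, $$\Big|\mathrm{sinc}(N\pi x)-\sum_{k=0}^nw_k\,\mathrm e^{-\pi\mathrm iNz_kx}\Big|\le\frac{36\,(1+\mathrm e^{-2CN})}{35\,(\mathrm e^2-1)}\,\mathrm e^{-N(\nu-C)}.$$ In other words, the error bound is exponentially decaying if $\nu>C\approx3.69$.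
   Context: $\mathbb N$ is the set of positive integers, and $\mathrm{sinc}(y)=\frac{\sin y}y$ for $y\ne0$, $\mathrm{sinc}(0)=1$. The coefficients $w_k$ are (half of) the Clenshaw–Curtis quadrature weights on $[-1,1]$. The last sentence of the claim means that for fixed $\nu>C$ the right-hand side of the inequality decays exponentially in $N$. *)

(* Defs.v *)
From Stdlib Require Export Reals.
From Coquelicot Require Export Coquelicot.

Open Scope R_scope.

Definition sinc (y : R) : R := if Req_EM_T y 0 then 1 else sin y / y.

Definition cexp (z : C) : C := (exp (Re z) * cos (Im z), exp (Re z) * sin (Im z)).

Definition cheb_point (n k : nat) : R := cos (INR k * PI / INR n).

(* Only used for k <= n. *)
Definition eps (n k : nat) : R :=
  if (Nat.eqb k 0 || Nat.eqb k n)%bool then sqrt 2 / 2 else 1.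

(* Coquelicot's [sum_n a m] is a 0 + ... + a m, both bounds included, and
   [Nat.div] is the floor of the quotient. *)
Definition cc_weight (n k : nat) : R :=
  1 / INR n * eps n k ^ 2 *
  sum_n (fun j : nat =>
           eps n (2 * j) ^ 2 * (2 / (1 - 4 * INR j ^ 2)) *
           cos (2 * INR j * INR k * PI / INR n))
        (Nat.div n 2).

Definition threshold : R := PI * (exp 1 ^ 2 - 1) / (2 * exp 1).

Definition error_bound (N : nat) (nu : R) : R :=
  36 * (1 + exp (- 2 * threshold * INR N)) / (35 * (exp 1 ^ 2 - 1)) *
  exp (- INR N * (nu - threshold)).

(* Main.v *)
Require Import Defs.
From Stdlib Require Import Reals Lra Lia ZArith Machin.
From Coquelicot Require Import Coquelicot.

Open Scope R_scope.

(** Put C = threshold, t = N pi x and f(z) = cos(tz).  The nodes and the weights are symmetric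
    under k -> n - k, so the sine part of the quadrature sum vanishes
    ([cc_sin_zero]), while sinc(t) is half the integral of f over [-1,1]
    ([is_RInt_sinc]).  The claim is therefore a bound for the quadrature error E
    of the single even function f, and E(f) is the sum of c_m E(T_2m) over the
    Chebyshev coefficients c_m of f.

    Size of the coefficients.  The Joukowski map w -> (w + 1/w)/2 turns T_k into
    (w^k + w^-k)/2 and sends the circle |w| = e to an ellipse on which
    |cos(tz)| is at most cosh(t sinh 1).  Averaging f against w^-k over roots of
    unity on that circle gives |c_m| <= 2 cosh(t sinh 1) e^(-2m) for m >= 1.  To stay with
    finite sums, cos(tz) is replaced by polynomials: (1 + z/d)^d converges to e^z
    uniformly on discs ([cexp_pow_approx]), so cos(tz) is within any eps of a
    polynomial, on the segment and on the ellipse alike.  The outcome is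
    [cos_cheb_approx].  Since threshold = pi sinh 1, the factor 2 cosh(t sinh 1)
    is at most e^(CN) (1 + e^(-2CN)).

    Size of E(T_2m).  The exact value of half the integral of T_2m is
    1/(1 - 4m^2).  Discrete orthogonality of cosines at the nodes shows that the
    quadrature reproduces it for 2m <= n ([cc_cos_low]), and for larger degrees it
    returns the value belonging to an aliased lower degree ([cc_cos_alias]).  Hence
    |E(T_2m)| <= 1 + 1/(4m^2 - 1) <= 36/35 once m >= 3.

    Summation.  For even n >= 4 the first nonzero term has degree n + 2, and the
    geometric series of ratio e^-2 gives exactly the constant
    36/(35 (e^2 - 1)) e^-n.  For odd n it starts one degree earlier, which costs a
    factor e; this is compensated by the aliased value in degree n + 1 being so
    close to the exact one that |E(T_(n+1))| <= 4/15.  For n = 2 the small error in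
    degree 6 makes up for |E(T_4)| = 16/15 > 36/35.  All this is
    [cc_defect_sum_bound].  For n = 1 the bound exceeds 2, which is trivially
    enough ([error_bound_two_nodes]). *)

(** * Complex moduli and finite sums *)

(** The values of [sum_n] have the carrier of a canonical structure as their
    type; [ring] and [field] only recognise the field itself. *)
Ltac R_eq := match goal with |- ?x = ?y => change (@eq R x y) end.
Ltac C_eq := match goal with |- ?x = ?y => change (@eq C x y) end.

Lemma Cmod_le_Re_Im (z : C) : Cmod z <= Rabs (Re z) + Rabs (Im z).
Proof.
  destruct z as [a b]; simpl.
  replace ((a, b) : C) with (RtoC a + Ci * RtoC b)%C
    by (apply injective_projections; simpl; ring).
  eapply Rle_trans; [apply Cmod_triangle|].
  rewrite Cmod_mult, Cmod_Ci, !Cmod_R; lra.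
Qed.

Lemma im_le_Cmod (z : C) : Rabs (Im z) <= Cmod z.
Proof.
  eapply Rle_trans; [apply Rmax_r | apply Rmax_Cmod].
Qed.

Lemma Re_mult_R (a : R) (z : C) : Re (RtoC a * z)%C = a * Re z.
Proof. destruct z; simpl; ring. Qed.

Lemma Cmod_sum_n_le (u : nat -> C) (n : nat) :
  Cmod (sum_n u n) <= sum_n (fun k => Cmod (u k)) n.
Proof.
  induction n as [|n IH]; [rewrite !sum_O; lra|].
  rewrite !sum_Sn; eapply Rle_trans; [apply Cmod_triangle|].
  apply Rplus_le_compat; [exact IH | apply Rle_refl].
Qed.

Lemma Rabs_sum_n_le (u : nat -> R) (n : nat) :
  Rabs (sum_n u n) <= sum_n (fun k => Rabs (u k)) n.
Proof.
  induction n as [|n IH]; [rewrite !sum_O; lra|].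
  rewrite !sum_Sn; eapply Rle_trans; [apply Rabs_triang|].
  apply Rplus_le_compat; [exact IH | apply Rle_refl].
Qed.

Lemma sum_n_le (u v : nat -> R) (n : nat) :
  (forall k, (k <= n)%nat -> u k <= v k) -> sum_n u n <= sum_n v n.
Proof.
  induction n as [|n IH]; intros H; [rewrite !sum_O; apply H; lia|].
  rewrite !sum_Sn; apply Rplus_le_compat; [apply IH; intros; apply H; lia | apply H; lia].
Qed.

Lemma Re_sum_n (u : nat -> C) (n : nat) : Re (sum_n u n) = sum_n (fun k => Re (u k)) n.
Proof.
  induction n as [|n IH]; [now rewrite !sum_O|].
  rewrite !sum_Sn, <- IH; reflexivity.
Qed.

Lemma Im_sum_n (u : nat -> C) (n : nat) : Im (sum_n u n) = sum_n (fun k => Im (u k)) n.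
Proof.
  induction n as [|n IH]; [now rewrite !sum_O|].
  rewrite !sum_Sn, <- IH; reflexivity.
Qed.

Lemma sum_n_zero {G : AbelianMonoid} (u : nat -> G) (n : nat) :
  (forall k, (k <= n)%nat -> u k = zero) -> sum_n u n = zero.
Proof.
  induction n as [|n IH]; intros H; [rewrite sum_O; apply H; lia|].
  rewrite sum_Sn, IH, H; [apply plus_zero_l | lia | intros; apply H; lia].
Qed.

Lemma sum_n_single {G : AbelianMonoid} (u : nat -> G) (n j : nat) :
  (j <= n)%nat -> (forall k, (k <= n)%nat -> k <> j -> u k = zero) -> sum_n u n = u j.
Proof.
  induction n as [|n IH]; intros Hj H.
  - rewrite sum_O; now replace j with O by lia.
  - rewrite sum_Sn; destruct (Nat.eq_dec j (S n)) as [->|Hne].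
    + rewrite sum_n_zero; [apply plus_zero_l | intros; apply H; lia].
    + rewrite IH, (H (S n)); [apply plus_zero_r | lia | lia | lia | intros; apply H; lia].
Qed.

Lemma sum_n_rev {G : AbelianMonoid} (u : nat -> G) (n : nat) :
  sum_n (fun k => u (n - k)%nat) n = sum_n u n.
Proof.
  revert u; induction n as [|n IH]; intros u; [now rewrite !sum_O|].
  rewrite sum_Sn, Nat.sub_diag.
  rewrite (sum_n_ext_loc _ (fun k => (fun i => u (S i)) (n - k)%nat));
    [|intros k Hk; f_equal; lia].
  rewrite (IH (fun i => u (S i))).
  clear IH; induction n as [|n IH].
  - rewrite sum_Sn, !sum_O; apply plus_comm.
  - rewrite sum_Sn, (sum_Sn u), <- IH.
    rewrite <- !plus_assoc; f_equal; apply plus_comm.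
Qed.

(** * The exponential as a limit of polynomials *)

Lemma cexp_plus (a b : C) : cexp (a + b)%C = (cexp a * cexp b)%C.
Proof.
  destruct a as [a1 a2], b as [b1 b2]; unfold cexp; simpl.
  rewrite exp_plus, cos_plus, sin_plus.
  apply injective_projections; simpl; ring.
Qed.

Lemma cexp_0 : cexp 0%C = 1%C.
Proof.
  unfold cexp; simpl; rewrite exp_0, cos_0, sin_0.
  apply injective_projections; simpl; ring.
Qed.

Lemma cexp_INR_mult (d : nat) (z : C) : cexp (RtoC (INR d) * z)%C = (cexp z ^ d)%C.
Proof.
  induction d as [|d IH].
  - simpl INR; rewrite Cmult_0_l, cexp_0; reflexivity.
  - rewrite S_INR, RtoC_plus, Cmult_plus_distr_r, cexp_plus, IH, Cmult_1_l, Cpow_S.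
    apply Cmult_comm.
Qed.

Lemma Cmod_cexp (z : C) : Cmod (cexp z) = exp (Re z).
Proof.
  assert (H : Cmod (cexp z) ^ 2 = exp (Re z) ^ 2).
  { rewrite Cmod2_alt; destruct z as [a b]; unfold cexp; simpl Re; simpl Im.
    pose proof (sin2_cos2 b) as E; unfold Rsqr in E.
    transitivity (exp a ^ 2 * (sin b * sin b + cos b * cos b)); [ring | rewrite E; ring]. }
  pose proof (Cmod_ge_0 (cexp z)); pose proof (exp_pos (Re z)); nra.
Qed.

Lemma exp_minus_affine_bound (a : R) : Rabs a <= 1/2 -> 0 <= exp a - 1 - a <= 2 * a ^ 2.
Proof.
  intros Ha; apply Rabs_le_between in Ha.
  pose proof (exp_ineq1_le a); pose proof (exp_ineq1_le (- a)).
  assert (E : exp a * exp (- a) = 1) by (rewrite <- exp_plus, Rplus_opp_r; apply exp_0).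
  pose proof (exp_pos a).
  split; [lra|].
  assert (exp a * (1 - a) <= 1) by nra.
  assert (exp a <= 1 + a + 2 * a ^ 2); [|lra].
  apply Rmult_le_reg_r with (1 - a); [lra|].
  eapply Rle_trans; [eassumption|]. nra.
Qed.

Lemma one_minus_cos_bound (b : R) : 0 <= 1 - cos b <= b ^ 2 / 2.
Proof.
  split; [pose proof (COS_bound b); lra|].
  replace b with (2 * (b / 2)) at 1 by field.
  rewrite cos_2a_sin.
  assert (Rabs (sin (b/2)) <= Rabs (b/2)).
  { destruct (Rtotal_order (b/2) 0) as [h|[h|h]].
    - pose proof (sin_gt_x _ h). unfold Rabs; repeat destruct Rcase_abs; try lra.
      pose proof (SIN_bound (b/2)). destruct (Rle_dec (-1) (b/2)).
      + assert (sin (b/2) < 0); [apply sin_lt_0_var; [pose proof PI_RGT_0; pose proof PI2_1; lra|lra]|lra].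
      + lra.
    - rewrite h, sin_0; lra.
    - pose proof (sin_lt_x _ h). unfold Rabs; repeat destruct Rcase_abs; try lra.
      pose proof (SIN_bound (b/2)). destruct (Rle_dec (b/2) 1).
      + assert (0 < sin (b/2)); [apply sin_gt_0; [lra|pose proof PI2_1; lra]|lra].
      + lra. }
  apply Rsqr_le_abs_1 in H; unfold Rsqr in H. nra.
Qed.

Lemma sin_minus_id_bound (b : R) : Rabs b <= 1/2 -> Rabs (sin b - b) <= b ^ 2 / 2.
Proof.
  assert (P : forall c, 0 <= c <= 1/2 -> Rabs (sin c - c) <= c ^ 2 / 2).
  { intros c [h1 h2].
    destruct (pre_sin_bound c 0 h1 ltac:(lra)) as [l _].
    unfold sin_approx, sin_term in l; simpl in l.
    assert (sin c <= c) by (destruct h1 as [h1| <-]; [left; apply sin_lt_x; lra | rewrite sin_0; lra]).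
    apply Rabs_le; split; [|nra].
    assert (c - c ^ 3 / 6 <= sin c) by (eapply Rle_trans; [|exact l]; right; field).
    assert (c ^ 3 / 6 <= c ^ 2 / 2) by nra. lra. }
  intros Hb; destruct (Rle_dec 0 b).
  - apply P; split; [lra|]. now rewrite Rabs_pos_eq in Hb by lra.
  - rewrite Rabs_left in Hb by lra.
    specialize (P (- b) ltac:(lra)). rewrite sin_neg in P.
    rewrite <- Rabs_Ropp. replace (- (sin b - b)) with (- sin b - - b) by ring.
    eapply Rle_trans; [exact P|]. right; field.
Qed.

(** Second-order accuracy of 1 + u is what makes the d-fold product of the
    factors 1 + z/d converge at rate 1/d. *)
Lemma cexp_minus_affine_bound (u : C) :
  Cmod u <= 1/2 -> Cmod (cexp u - 1 - u)%C <= 3 * Cmod u ^ 2.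
Proof.
  intros Hu; rewrite Cmod2_alt.
  pose proof (Rle_trans _ _ _ (re_le_Cmod u) Hu) as Ha.
  pose proof (Rle_trans _ _ _ (im_le_Cmod u) Hu) as Hb.
  destruct u as [a b]; unfold cexp; simpl Re in *; simpl Im in *.
  eapply Rle_trans; [apply Cmod_le_Re_Im|]; simpl Re; simpl Im.
  destruct (exp_minus_affine_bound a Ha) as [e1 e2].
  destruct (one_minus_cos_bound b) as [c1 c2].
  pose proof (sin_minus_id_bound b Hb) as s.
  apply Rabs_le_between in Ha.
  assert (ea : exp a <= 2) by nra.
  pose proof (exp_pos a) as ep.
  assert (R1 : Rabs (exp a * cos b + - (1) + - a) <= 2 * a ^ 2 + b ^ 2).
  { apply Rabs_le; split; nra. }
  assert (R2 : Rabs (exp a * sin b + - 0 + - b) <= a ^ 2 + 2 * b ^ 2).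
  { replace (exp a * sin b + - 0 + - b) with (exp a * (sin b - b) + (exp a - 1) * b) by ring.
    eapply Rle_trans; [apply Rabs_triang|]. rewrite !Rabs_mult, (Rabs_pos_eq (exp a)) by lra.
    assert (Rabs (exp a - 1) <= 2 * Rabs a).
    { unfold Rabs; repeat destruct Rcase_abs; nra. }
    assert (exp a * Rabs (sin b - b) <= 2 * (b ^ 2 / 2)).
    { apply Rmult_le_compat; try lra; apply Rabs_pos. }
    assert (Rabs (exp a - 1) * Rabs b <= 2 * Rabs a * Rabs b).
    { apply Rmult_le_compat_r; [apply Rabs_pos|lra]. }
    rewrite <- (pow2_abs a), <- (pow2_abs b) in *.
    pose proof (pow2_ge_0 (Rabs a - Rabs b)). nra. }
  simpl. simpl in R1, R2. lra.
Qed.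

(** Telescoping a^(d+1) - b^(d+1) into d + 1 products, each with one factor
    a - b. *)
Lemma Cmod_pow_minus_pow (a b : C) (G : R) (d : nat) :
  Cmod a <= G -> Cmod b <= G ->
  Cmod (a ^ S d - b ^ S d)%C <= INR (S d) * G ^ d * Cmod (a - b)%C.
Proof.
  intros Ha Hb.
  assert (G0 : 0 <= G) by (eapply Rle_trans; [apply Cmod_ge_0|eassumption]).
  induction d as [|d IH].
  - rewrite !Cpow_1_r; simpl; lra.
  - replace (a ^ S (S d) - b ^ S (S d))%C
      with (a * (a ^ S d - b ^ S d) + (a - b) * b ^ S d)%C by (rewrite !(Cpow_S _ (S d)); ring).
    eapply Rle_trans; [apply Cmod_triangle|]; rewrite !Cmod_mult, Cmod_pow.
    rewrite (S_INR (S d)).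
    apply Rle_trans with (G * (INR (S d) * G ^ d * Cmod (a - b)%C) + Cmod (a - b)%C * G ^ S d).
    + apply Rplus_le_compat.
      * apply Rmult_le_compat; try assumption; apply Cmod_ge_0.
      * apply Rmult_le_compat_l; [apply Cmod_ge_0|]. apply pow_incr; split; [apply Cmod_ge_0|assumption].
    + right; simpl; ring.
Qed.

(** Both e^z and (1 + z/d)^d are d-th powers, of e^(z/d) and 1 + z/d, which
    differ by at most 3 r^2/d^2 and are bounded by e^(r/d); so the powers differ
    by at most 3 r^2 e^r / d.  A power of an affine function is used rather than
    a Taylor polynomial because its approximation property and its Chebyshev
    expansion both follow from one factor. *)
Lemma cexp_pow_approx (r eps : R) :
  0 <= r -> 0 < eps ->
  exists d : nat, forall z : C, Cmod z <= r ->
    Cmod (cexp z - (1 + z * RtoC (/ INR (S d))) ^ S d)%C <= eps.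
Proof.
  intros Hr He.
  (* [B / S d] bounds the error; [2 * r <= S d] keeps z / S d in the range of
     [cexp_minus_affine_bound]. *)
  set (B := 3 * r ^ 2 * exp r).
  pose proof (exp_pos r) as er.
  assert (HB : 0 <= B) by (unfold B; nra).
  destruct (nfloor_ex (2 * r + B / eps)) as [d [_ Hd]].
  { assert (0 <= B / eps) by (apply Rdiv_le_0_compat; lra). lra. }
  exists d; intros z Hz.
  rewrite <- S_INR in Hd.
  assert (HL : 0 < INR (S d)) by (apply lt_0_INR; lia).
  assert (HBe : 0 <= B / eps) by (apply Rdiv_le_0_compat; lra).
  set (L := INR (S d)) in *.
  set (u := (z * RtoC (/ L))%C).
  assert (Ez : z = (RtoC L * u)%C).
  { unfold u; rewrite RtoC_inv by lra. field. intros H; apply RtoC_inj in H; lra. }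
  assert (Hu : Cmod u = Cmod z / L).
  { unfold u; rewrite Cmod_mult, Cmod_R, Rabs_pos_eq; [reflexivity|]. left; apply Rinv_0_lt_compat; lra. }
  assert (Hur : Cmod u <= r / L).
  { rewrite Hu; apply Rmult_le_compat_r; [left; apply Rinv_0_lt_compat; lra|lra]. }
  assert (Hrl : r / L <= 1/2).
  { apply Rmult_le_reg_r with L; [lra|]. unfold Rdiv at 1. rewrite Rmult_assoc, Rinv_l; lra. }
  rewrite Ez at 1. unfold L at 1. rewrite cexp_INR_mult.
  assert (Hg1 : Cmod (cexp u) <= exp (r / L)).
  { rewrite Cmod_cexp. pose proof (re_le_Cmod u). pose proof (Rle_abs (Re u)).
    destruct (Rle_lt_or_eq_dec (Re u) (r / L)) as [h|h]; [lra|left; now apply exp_increasing|rewrite h; lra]. }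
  assert (Hg2 : Cmod (1 + u)%C <= exp (r / L)).
  { eapply Rle_trans; [apply Cmod_triangle|]. rewrite Cmod_1.
    pose proof (exp_ineq1_le (r / L)). lra. }
  eapply Rle_trans; [apply (Cmod_pow_minus_pow _ _ _ d Hg1 Hg2)|].
  replace (cexp u - (1 + u))%C with (cexp u - 1 - u)%C by ring.
  pose proof (cexp_minus_affine_bound u ltac:(lra)) as Hq.
  assert (HP : exp (r / L) ^ d <= exp r).
  { rewrite <- Rpower_pow by apply exp_pos. unfold Rpower. rewrite ln_exp.
    assert (INR d * (r / L) <= r).
    { apply Rmult_le_reg_r with L; [lra|].
      replace (INR d * (r / L) * L) with (INR d * r) by (field; lra).
      unfold L; rewrite S_INR. nra. }
    destruct H as [h|h]; [left; now apply exp_increasing|rewrite h; lra]. }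
  fold L.
  apply Rle_trans with (L * exp r * (3 * (r / L) ^ 2)).
  - apply Rmult_le_compat.
    + apply Rmult_le_pos; [lra|]. apply pow_le; left; apply exp_pos.
    + apply Cmod_ge_0.
    + apply Rmult_le_compat_l; lra.
    + eapply Rle_trans; [exact Hq|]. apply Rmult_le_compat_l; [lra|].
      apply pow_incr; split; [apply Cmod_ge_0|lra].
  - replace (L * exp r * (3 * (r / L) ^ 2)) with (B / L) by (unfold B; field; lra).
    apply Rmult_le_reg_r with L; [lra|]. unfold Rdiv at 1; rewrite Rmult_assoc, Rinv_l by lra.
    apply Rmult_le_reg_r with (/ eps); [now apply Rinv_0_lt_compat|].
    replace (eps * L * / eps) with L by (field; lra).
    unfold Rdiv in *; lra.
Qed.

(** * Chebyshev expansions of polynomials *)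

(** The Chebyshev polynomial T_k at (w + 1/w)/2; on the unit circle
    w = e^(i th) it is cos(k th). *)
Definition cheb_lift (k : nat) (w : C) : C := ((w ^ k + (/ w) ^ k) / 2)%C.

Definition joukowski (w : C) : C := cheb_lift 1 w.

(** The identity is required of every truncation beyond [d], so that two
    expansions can be added without padding and the truncation can be chosen to
    suit a sum over roots of unity. *)
Definition cheb_expansion (F : C -> C) (b : nat -> C) (d : nat) : Prop :=
  forall D, (d <= D)%nat -> forall w : C, w <> 0%C ->
    F w = sum_n (fun k => b k * cheb_lift k w)%C D.

Definition cheb_expandable (F : C -> C) : Prop :=
  exists b d, cheb_expansion F b d.

Lemma cheb_expandable_basis (j : nat) (F : C -> C) :
  (forall w : C, w <> 0%C -> F w = cheb_lift j w) ->
  cheb_expandable F.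
Proof.
  intros HF; exists (fun k => if Nat.eq_dec k j then 1%C else 0%C), j.
  intros D HD w Hw; rewrite (HF w Hw).
  rewrite (sum_n_single _ D j HD).
  - destruct (Nat.eq_dec j j) as [_|n]; [ring | now destruct n].
  - intros k _ Hk; destruct (Nat.eq_dec k j) as [e|_]; [now destruct Hk|].
    apply Cmult_0_l.
Qed.

Lemma cheb_expandable_lincomb (x y : C) (F G : C -> C) :
  cheb_expandable F -> cheb_expandable G ->
  cheb_expandable (fun w => x * F w + y * G w)%C.
Proof.
  intros (b & d & HF) (c & e & HG).
  exists (fun k => x * b k + y * c k)%C, (max d e); intros D HD w Hw.
  rewrite (HF D), (HG D) by (assumption || lia).
  symmetry.
  transitivity (sum_n (fun k => plus (mult x (b k * cheb_lift k w)%C)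
                                   (mult y (c k * cheb_lift k w)%C)) D).
  - apply sum_n_ext; intros k; change ((x * b k + y * c k) * cheb_lift k w
      = x * (b k * cheb_lift k w) + y * (c k * cheb_lift k w))%C; ring.
  - rewrite sum_n_plus, !sum_n_mult_l; reflexivity.
Qed.

Lemma cheb_expandable_ext (F G : C -> C) :
  (forall w : C, w <> 0%C -> F w = G w) ->
  cheb_expandable F -> cheb_expandable G.
Proof.
  intros E (b & d & H); exists b, d; intros D HD w Hw; rewrite <- E by assumption; now apply H.
Qed.

Lemma cheb_lift_0 (w : C) : cheb_lift 0 w = 1%C.
Proof. unfold cheb_lift; simpl; field. Qed.

Lemma two_C_neq_0 : RtoC 2 <> 0%C.
Proof. intros H; apply RtoC_inj in H; lra. Qed.

(** The three-term recurrence z T_(k+1) = (T_(k+2) + T_k)/2. *)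
Lemma joukowski_mult_cheb_lift (k : nat) (w : C) : w <> 0%C ->
  (joukowski w * cheb_lift (S k) w
   = RtoC (1/2) * cheb_lift (S (S k)) w + RtoC (1/2) * cheb_lift k w)%C.
Proof.
  intros Hw; unfold joukowski, cheb_lift.
  replace (RtoC (1/2)) with (/ 2)%C
    by (unfold Rdiv; rewrite Rmult_1_l, RtoC_inv by lra; reflexivity).
  rewrite !Cpow_S; simpl Cpow.
  generalize (w ^ k)%C, ((/ w) ^ k)%C; intros p q.
  field; exact Hw.
Qed.

Lemma cheb_expandable_joukowski_mult (F : C -> C) :
  cheb_expandable F ->
  cheb_expandable (fun w => joukowski w * F w)%C.
Proof.
  intros (b & d & HF).
  apply cheb_expandable_ext with
    (fun w => joukowski w * sum_n (fun k => b k * cheb_lift k w)%C d)%C.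
  { intros w Hw; rewrite (HF d) by (assumption || lia); reflexivity. }
  clear HF F.
  assert (Hk : forall k, cheb_expandable (fun w => joukowski w * cheb_lift k w)%C).
  { intros [|k].
    - apply (cheb_expandable_basis 1); intros w _; rewrite cheb_lift_0; apply Cmult_1_r.
    - eapply cheb_expandable_ext;
        [intros w Hw; symmetry; apply (joukowski_mult_cheb_lift k w Hw)|].
      apply cheb_expandable_lincomb;
        [apply (cheb_expandable_basis (S (S k)))|apply (cheb_expandable_basis k)]; reflexivity. }
  induction d as [|d IH].
  - eapply cheb_expandable_ext; [|apply (cheb_expandable_lincomb (b 0%nat) 0%C _ _ (Hk 0%nat) (Hk 0%nat))].
    intros w _; rewrite sum_O. ring.
  - eapply cheb_expandable_ext; [|apply (cheb_expandable_lincomb 1%C (b (S d)) _ _ IH (Hk (S d)))].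
    intros w _; rewrite sum_Sn; change plus with Cplus; ring.
Qed.

Lemma cheb_expandable_affine_pow (c : C) (n : nat) :
  cheb_expandable (fun w => (1 + c * joukowski w) ^ n)%C.
Proof.
  induction n as [|n IH].
  - apply (cheb_expandable_basis 0); intros w _; now rewrite cheb_lift_0.
  - eapply cheb_expandable_ext;
      [|apply (cheb_expandable_lincomb 1%C c _ _ IH (cheb_expandable_joukowski_mult _ IH))].
    intros w _; rewrite Cpow_S; ring.
Qed.

(** * Coefficients from sums over roots of unity *)

Definition cis (a : R) : C := (cos a, sin a).

Lemma cis_plus (a b : R) : cis (a + b) = (cis a * cis b)%C.
Proof.
  unfold cis; rewrite cos_plus, sin_plus; apply injective_projections; simpl; ring.
Qed.

Lemma cis_0 : cis 0 = 1%C.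
Proof. unfold cis; now rewrite cos_0, sin_0. Qed.

Lemma Cmod_cis (a : R) : Cmod (cis a) = 1.
Proof.
  assert (H : Cmod (cis a) ^ 2 = 1).
  { rewrite Cmod2_alt; unfold cis; simpl Re; simpl Im.
    pose proof (sin2_cos2 a) as E; unfold Rsqr in E; lra. }
  pose proof (Cmod_ge_0 (cis a)); nra.
Qed.

Lemma cis_neq_0 (a : R) : cis a <> 0%C.
Proof. intros H; pose proof (Cmod_cis a) as E; rewrite H, Cmod_0 in E; lra. Qed.

Lemma cis_opp (a : R) : cis (- a) = (/ cis a)%C.
Proof.
  assert (E : (cis a * cis (- a))%C = 1%C) by (rewrite <- cis_plus, Rplus_opp_r; apply cis_0).
  rewrite <- (Cmult_1_l (/ cis a)%C), <- E.
  field. apply cis_neq_0.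
Qed.

Lemma cis_INR_mult (n : nat) (a : R) : cis (INR n * a) = (cis a ^ n)%C.
Proof.
  induction n as [|n IH].
  - simpl INR; rewrite Rmult_0_l; apply cis_0.
  - rewrite S_INR, Rmult_plus_distr_r, cis_plus, IH, Rmult_1_l, Cpow_S; apply Cmult_comm.
Qed.

Lemma geometric_sum (q : C) (n : nat) :
  ((1 - q) * sum_n (fun l => q ^ l)%C n = 1 - q ^ S n)%C.
Proof.
  induction n as [|n IH].
  - rewrite sum_O; simpl; ring.
  - rewrite sum_Sn; change plus with Cplus.
    rewrite Cmult_plus_distr_l, IH, !Cpow_S; ring.
Qed.

(** A geometric sum whose ratio is an N-th root of unity, N = M + 1, and is
    different from 1 exactly because N does not divide z. *)
Lemma cis_sum (z : Z) (M : nat) :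
  (forall q : Z, z <> q * Z.of_nat (S M))%Z ->
  sum_n (fun l => cis (INR l * (IZR z * (2 * PI) / INR (S M)))) M = RtoC 0.
Proof.
  intros Hz; set (a := IZR z * (2 * PI) / INR (S M)).
  assert (HL : 0 < INR (S M)) by (apply lt_0_INR; lia).
  pose proof PI_RGT_0 as Hpi.
  rewrite (sum_n_ext _ (fun l => (cis a ^ l)%C)) by (intros l; apply cis_INR_mult).
  assert (Hq : (1 - cis a)%C <> RtoC 0).
  { intros H.
    assert (Hc : cos a = 1) by (apply (f_equal Re) in H; simpl in H; lra).
    replace a with (2 * (a / 2)) in Hc by field.
    rewrite cos_2a_sin in Hc.
    assert (Hs : sin (a / 2) = 0) by nra.
    destruct (sin_eq_0_0 _ Hs) as [q Eq]. apply (Hz q).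
    apply eq_IZR. rewrite mult_IZR, <- INR_IZR_INZ.
    unfold a in Eq.
    apply Rmult_eq_reg_r with (PI / INR (S M)).
    - transitivity (IZR z * (2 * PI) / INR (S M) / 2); [field; lra|]. rewrite Eq; field; lra.
    - apply Rgt_not_eq, Rdiv_lt_0_compat; lra. }
  assert (E : ((1 - cis a) * sum_n (fun l => cis a ^ l) M)%C = RtoC 0).
  { rewrite geometric_sum, <- cis_INR_mult.
    replace (INR (S M) * a) with (2 * (IZR z * PI)) by (unfold a; field; lra).
    replace (cis (2 * (IZR z * PI))) with (RtoC 1); [change (RtoC 1 - RtoC 1 = RtoC 0)%C; ring|].
    unfold cis. rewrite cos_2a_sin, sin_2a, (sin_eq_0_1 (IZR z * PI)) by (now exists z).
    apply injective_projections; simpl; ring. }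
  destruct (Ceq_dec (sum_n (fun l => cis a ^ l)%C M) 0%C) as [h|h]; [exact h|].
  exfalso; now apply (Cmult_neq_0 _ _ Hq h).
Qed.

(** Cauchy's estimate, with the contour integral replaced by an average over
    more than 2 D equidistant points of the circle |w| = rho: such an average of
    w^j times e^(-ik th) is exact for all |j| <= D, and it isolates the term
    b_k rho^k / 2. *)
Lemma cheb_expansion_coeff_bound (F : C -> C) (b : nat -> C) (d : nat) (rho M : R) :
  cheb_expansion F b d -> 0 < rho ->
  (forall a : R, Cmod (F (RtoC rho * cis a)%C) <= M) ->
  forall k, (1 <= k)%nat -> Cmod (b k) <= 2 * M / rho ^ k.
Proof.
  intros HF Hr HM k Hk.
  set (D := max d k); set (N := (2 * D)%nat).
  assert (HD : (d <= D)%nat /\ (k <= D)%nat) by (unfold D; lia).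
  set (L := INR (S N)).
  assert (HL : 0 < L) by (apply lt_0_INR; lia).
  set (th := fun l : nat => INR l * (2 * PI / L)).
  set (w := fun l => (RtoC rho * cis (th l))%C).
  assert (Hrc : RtoC rho <> RtoC 0) by (intros H; apply RtoC_inj in H; lra).
  assert (Hw : forall l, w l <> RtoC 0) by (intros l; apply Cmult_neq_0; [assumption|apply cis_neq_0]).
  assert (Hrk : 0 < rho ^ k) by now apply pow_lt.
  assert (Hterm : forall j l, (cheb_lift j (w l) * cis (- (INR k * th l)))%C =
     plus (mult (RtoC (rho ^ j) / 2)%C (cis (INR l * (IZR (Z.of_nat j - Z.of_nat k) * (2 * PI) / L))))
          (mult (RtoC (/ rho ^ j) / 2)%C (cis (INR l * (IZR (- Z.of_nat j - Z.of_nat k) * (2 * PI) / L))))).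
  { intros j l. change plus with Cplus; change mult with Cmult.
    replace (INR l * (IZR (Z.of_nat j - Z.of_nat k) * (2 * PI) / L))
      with (INR j * th l + - (INR k * th l))
      by (unfold th; rewrite minus_IZR, <- !INR_IZR_INZ; field; lra).
    replace (INR l * (IZR (- Z.of_nat j - Z.of_nat k) * (2 * PI) / L))
      with (INR j * (- th l) + - (INR k * th l))
      by (unfold th; rewrite minus_IZR, opp_IZR, <- !INR_IZR_INZ; field; lra).
    rewrite !(cis_plus (INR j * _)), !cis_INR_mult, (cis_opp (th l)).
    unfold cheb_lift, w.
    assert (H0 := cis_neq_0 (th l)).
    rewrite Cpow_inv, Cpow_mult_l by now apply Cmult_neq_0.
    rewrite Cpow_inv by assumption.
    rewrite RtoC_inv by (apply Rgt_not_eq, pow_lt; lra). rewrite RtoC_pow.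
    pose proof (Cpow_nz _ j Hrc) as P1. pose proof (Cpow_nz _ j H0) as P2.
    field; repeat split; assumption. }
  assert (Hsum : sum_n (fun l => F (w l) * cis (- (INR k * th l)))%C N
                 = (b k * (RtoC (rho ^ k) / 2) * RtoC L)%C).
  { rewrite (sum_n_ext _ (fun l => sum_n (fun j => mult (b j)
       (cheb_lift j (w l) * cis (- (INR k * th l)))%C) D)).
    2:{ intros l; rewrite (HF D) by (apply HD || apply Hw).
        rewrite <- (sum_n_mult_r (K := C_Ring) (cis (- (INR k * th l)))).
        apply sum_n_ext; intros j. symmetry; apply Cmult_assoc. }
    rewrite sum_n_switch.
    rewrite (sum_n_ext_loc _ (fun j => mult (b j)
       (plus (mult (RtoC (rho ^ j) / 2)%C (sum_n (fun l => cis (INR l * (IZR (Z.of_nat j - Z.of_nat k) * (2 * PI) / L))) N))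
          (mult (RtoC (/ rho ^ j) / 2)%C (sum_n (fun l => cis (INR l * (IZR (- Z.of_nat j - Z.of_nat k) * (2 * PI) / L))) N))))).
    2:{ intros j Hj. rewrite sum_n_mult_l. f_equal.
        rewrite (sum_n_ext _ _ _ (Hterm j)), sum_n_plus.
        f_equal; apply (sum_n_mult_l (K := C_Ring)). }
    assert (Z2 : forall j, (j <= D)%nat ->
       sum_n (fun l => cis (INR l * (IZR (- Z.of_nat j - Z.of_nat k) * (2 * PI) / L))) N = RtoC 0).
    { intros j Hj; apply cis_sum; intros q E. unfold N in E.
      rewrite Nat2Z.inj_succ, Nat2Z.inj_mul in E. change (Z.of_nat 2) with 2%Z in E.
      destruct HD as [_ HD]. apply Nat2Z.inj_le in HD, Hj, Hk. change (Z.of_nat 1) with 1%Z in Hk.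
      destruct (Z_lt_le_dec q 0); nia. }
    rewrite (sum_n_single _ D k); [|apply HD|].
    - rewrite Z2 by apply HD. rewrite Z.sub_diag.
      rewrite (sum_n_ext _ (fun _ => RtoC 1)).
      2:{ intros l; replace (INR l * (0 * (2 * PI) / L)) with 0 by (field; lra). apply cis_0. }
      replace (sum_n (fun _ : nat => RtoC 1) N) with (RtoC L).
      + change plus with Cplus; change mult with Cmult.
        C_eq. ring.
      + unfold L. clear. induction N as [|N IH].
        * rewrite sum_O; reflexivity.
        * rewrite sum_Sn, <- IH, (S_INR (S N)), RtoC_plus; reflexivity.
    - intros j Hj Hne. rewrite Z2 by assumption.
      assert (Z1 : sum_n (fun l => cis (INR l * (IZR (Z.of_nat j - Z.of_nat k) * (2 * PI) / L))) N = RtoC 0).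
      { apply cis_sum; intros q E. unfold N in E.
        rewrite Nat2Z.inj_succ, Nat2Z.inj_mul in E. change (Z.of_nat 2) with 2%Z in E.
        assert (Hne' : Z.of_nat j <> Z.of_nat k) by (intros e; now apply Hne, Nat2Z.inj).
        destruct HD as [_ HD]. apply Nat2Z.inj_le in HD, Hj.
        assert (q < 0 \/ q = 0 \/ 0 < q)%Z as [h|[h|h]] by lia; nia. }
      rewrite Z1. change plus with Cplus; change mult with Cmult; change zero with (RtoC 0).
      C_eq. ring. }
  assert (Hb : Cmod (b k) * (rho ^ k / 2) * L <= L * M).
  { replace (Cmod (b k) * (rho ^ k / 2) * L) with (Cmod (b k * (RtoC (rho ^ k) / 2) * RtoC L)%C).
    - rewrite <- Hsum. eapply Rle_trans; [apply Cmod_sum_n_le|].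
      unfold L; rewrite <- sum_n_const. apply sum_n_le; intros l _.
      rewrite Cmod_mult, Cmod_cis, Rmult_1_r. apply HM.
    - rewrite !Cmod_mult, Cmod_div, !Cmod_R, !Rabs_pos_eq by (lra || exact two_C_neq_0). reflexivity. }
  apply Rmult_le_reg_r with (rho ^ k / 2 * L); [apply Rmult_lt_0_compat; lra|].
  replace (2 * M / rho ^ k * (rho ^ k / 2 * L)) with (L * M) by (field; lra). lra.
Qed.

(** * Chebyshev approximation of the cosine *)

(** The image of the circle |w| = e is the ellipse with half-axes cosh 1 and
    sinh 1; the imaginary half-axis is what governs the growth of cos(tz). *)
Lemma joukowski_circle (th : R) :
  joukowski (RtoC (exp 1) * cis th)%C = (cosh 1 * cos th, sinh 1 * sin th).
Proof.
  unfold joukowski, cheb_lift, cosh, sinh.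
  rewrite !Cpow_1_r.
  assert (E : (/ (RtoC (exp 1) * cis th))%C = (RtoC (exp (- (1))) * cis (- th))%C).
  { rewrite cis_opp, exp_Ropp, RtoC_inv by (apply Rgt_not_eq, exp_pos).
    field; split; [apply cis_neq_0|].
    intros H; apply RtoC_inj in H; pose proof (exp_pos 1); lra. }
  rewrite E; unfold cis; rewrite cos_neg, sin_neg.
  apply injective_projections; simpl; field.
Qed.

Lemma cheb_lift_cis (k : nat) (th : R) : cheb_lift k (cis th) = RtoC (cos (INR k * th)).
Proof.
  unfold cheb_lift; rewrite <- cis_opp, <- !cis_INR_mult.
  replace (INR k * - th) with (- (INR k * th)) by ring.
  unfold cis; rewrite cos_neg, sin_neg.
  apply injective_projections; simpl; field.
Qed.

Lemma cosh_even_mono (x y : R) : Rabs x <= Rabs y -> cosh x <= cosh y.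
Proof.
  assert (P : forall u v, 0 <= u <= v -> cosh u <= cosh v).
  { intros u v [h1 h2]; unfold cosh. rewrite !exp_Ropp.
    assert (1 <= exp u) by (pose proof (exp_ineq1_le u); lra).
    assert (exp u <= exp v) by (destruct h2 as [h2| <-]; [left; now apply exp_increasing|lra]).
    set (p := exp u) in *; set (q := exp v) in *.
    assert (p + / p <= q + / q); [|lra].
    apply Rmult_le_reg_r with (p * q); [nra|].
    replace ((p + / p) * (p * q)) with (p * p * q + q) by (field; lra).
    replace ((q + / q) * (p * q)) with (p * q * q + p) by (field; lra).
    assert (0 <= (q - p) * (p * q - 1)) by (apply Rmult_le_pos; nra). nra. }
  assert (Q : forall u, cosh u = cosh (Rabs u)).
  { intros u; unfold Rabs; destruct Rcase_abs; [|reflexivity].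
    unfold cosh; rewrite Ropp_involutive; lra. }
  intros H; rewrite (Q x), (Q y); apply P; split; [apply Rabs_pos|assumption].
Qed.

Lemma sum_n_pairs (u : nat -> R) (K : nat) :
  sum_n u (2 * K + 1) = sum_n (fun m => u (2 * m)%nat + u (2 * m + 1)%nat) K.
Proof.
  induction K as [|K IH].
  - simpl; rewrite sum_Sn, !sum_O; reflexivity.
  - replace (2 * S K + 1)%nat with (S (S (2 * K + 1))) by lia.
    rewrite !sum_Sn, IH.
    change plus with Rplus.
    replace (S (2 * K + 1)) with (2 * S K)%nat by lia.
    replace (S (2 * S K)) with (2 * S K + 1)%nat by lia.
    apply Rplus_assoc.
Qed.

Lemma cos_nat_PI_minus (k : nat) (th : R) :
  cos (INR k * (PI - th)) = (-1) ^ k * cos (INR k * th).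
Proof.
  replace (INR k * (PI - th)) with (INR k * PI - INR k * th) by ring.
  rewrite cos_minus.
  assert (H : forall j : nat, cos (INR j * PI) = (-1) ^ j /\ sin (INR j * PI) = 0).
  { induction j as [|j [IH1 IH2]].
    - simpl; rewrite Rmult_0_l, cos_0, sin_0; auto.
    - rewrite S_INR, Rmult_plus_distr_r, Rmult_1_l, neg_cos, neg_sin, IH1, IH2; simpl; lra. }
  destruct (H k) as [-> ->]; ring.
Qed.

(** The approximating polynomial is the mean of (1 + itz/d)^d and (1 - itz/d)^d
    for large d.  It is eps-close to cos(tz) for |z| <= 2, a disc containing both
    the segment [-1,1] and the ellipse; on the latter it is at most
    cosh(t sinh 1) + eps, whence the decay of its coefficients.  Averaging its
    real part over th and PI - th removes the odd degrees. *)
Lemma cos_cheb_approx (t eps : R) : 0 < eps ->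
  exists (c : nat -> R) (K : nat),
    (forall th : R,
       Rabs (cos (t * cos th) - sum_n (fun m => c m * cos (2 * INR m * th)) K) <= eps) /\
    (forall m, (1 <= m)%nat ->
       Rabs (c m) <= 2 * (cosh (t * sinh 1) + eps) * exp (-2) ^ m).
Proof.
  intros He.
  assert (Hr : 0 <= 2 * Rabs t) by (pose proof (Rabs_pos t); lra).
  destruct (cexp_pow_approx _ _ Hr He) as [d Hd].
  set (P := fun z : C => ((1 + (Ci * RtoC t * z) * RtoC (/ INR (S d))) ^ S d / 2
                        + (1 + (- (Ci * RtoC t * z)) * RtoC (/ INR (S d))) ^ S d / 2)%C).
  assert (HP : forall z, Cmod z <= 2 ->
     Cmod ((cexp (Ci * RtoC t * z) + cexp (- (Ci * RtoC t * z))) / 2 - P z)%C <= eps).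
  { intros z Hz.
    assert (Hz' : Cmod (Ci * RtoC t * z)%C <= 2 * Rabs t).
    { rewrite !Cmod_mult, Cmod_Ci, Cmod_R. pose proof (Rabs_pos t). nra. }
    pose proof (Hd _ Hz') as H1. rewrite <- Cmod_opp in Hz'. pose proof (Hd _ Hz') as H2.
    unfold P.
    set (A1 := (1 + _ * _)%C) in H1; set (A2 := (1 + _ * _)%C) in H2.
    fold A1 A2.
    set (E1 := cexp (Ci * RtoC t * z)) in *; set (E2 := cexp _) in H2. fold E2.
    replace ((E1 + E2) / 2 - (A1 ^ S d / 2 + A2 ^ S d / 2))%C
      with (((E1 - A1 ^ S d) + (E2 - A2 ^ S d)) / 2)%C by field.
    rewrite Cmod_div by exact two_C_neq_0.
    rewrite Cmod_R, (Rabs_pos_eq 2) by lra.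
    pose proof (Cmod_triangle (E1 - A1 ^ S d) (E2 - A2 ^ S d))%C. lra. }
  assert (HF : cheb_expandable (fun w => P (joukowski w))).
  { set (a := (Ci * RtoC t * RtoC (/ INR (S d)))%C).
    eapply cheb_expandable_ext;
      [|apply (cheb_expandable_lincomb (/ 2)%C (/ 2)%C _ _
          (cheb_expandable_affine_pow a (S d)) (cheb_expandable_affine_pow (- a)%C (S d)))].
    intros w _; unfold P.
    replace (Ci * RtoC t * joukowski w * RtoC (/ INR (S d)))%C with (a * joukowski w)%C
      by (unfold a; ring).
    replace (- (Ci * RtoC t * joukowski w) * RtoC (/ INR (S d)))%C with (- a * joukowski w)%C
      by (unfold a; ring).
    unfold Cdiv; ring. }
  destruct HF as (b & d0 & HF).
  assert (Hb : forall k, (1 <= k)%nat ->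
            Cmod (b k) <= 2 * (cosh (t * sinh 1) + eps) / exp 1 ^ k).
  { apply (cheb_expansion_coeff_bound _ b d0 _ _ HF (exp_pos 1)); intros th.
    rewrite joukowski_circle.
    set (z := (cosh 1 * cos th, sinh 1 * sin th) : C).
    assert (Hz : Cmod z <= 2).
    { rewrite <- (joukowski_circle th : _ = z). unfold joukowski, cheb_lift. rewrite !Cpow_1_r.
      assert (N0 : (RtoC (exp 1) * cis th)%C <> RtoC 0).
      { apply Cmult_neq_0; [|apply cis_neq_0]. intros H; apply RtoC_inj in H; pose proof (exp_pos 1); lra. }
      rewrite Cmod_div by exact two_C_neq_0.
      rewrite Cmod_R, (Rabs_pos_eq 2) by lra.
      eapply Rle_trans; [apply Rmult_le_compat_r, Cmod_triangle; lra|].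
      rewrite Cmod_inv, Cmod_mult, Cmod_cis, Cmod_R, Rmult_1_r by assumption.
      rewrite Rabs_pos_eq by (left; apply exp_pos).
      pose proof exp_le_3. pose proof (exp_ineq1_le 1).
      assert (/ exp 1 <= / 1) by (apply Rinv_le_contravar; lra). lra. }

    replace (P z) with ((cexp (Ci * RtoC t * z) + cexp (- (Ci * RtoC t * z))) / 2
       + - ((cexp (Ci * RtoC t * z) + cexp (- (Ci * RtoC t * z))) / 2 - P z))%C by ring.
    eapply Rle_trans; [apply Cmod_triangle|]. rewrite Cmod_opp.
    apply Rplus_le_compat; [|now apply HP].
    rewrite Cmod_div by exact two_C_neq_0.
    rewrite Cmod_R, (Rabs_pos_eq 2) by lra.
    eapply Rle_trans; [apply Rmult_le_compat_r, Cmod_triangle; lra|].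
    rewrite !Cmod_cexp.
    set (y := t * sinh 1 * sin th).
    replace (Re (Ci * RtoC t * z)%C) with (- y) by (unfold y, z; simpl; ring).
    replace (Re (- (Ci * RtoC t * z))%C) with y by (unfold y, z; simpl; ring).
    replace ((exp (- y) + exp y) * / 2) with (cosh y) by (unfold cosh; field).
    apply cosh_even_mono. unfold y; rewrite (Rabs_mult (t * sinh 1)).
    pose proof (Rabs_pos (t * sinh 1)).
    assert (Rabs (sin th) <= 1) by (apply Rabs_le, SIN_bound).
    rewrite <- (Rmult_1_r (Rabs (t * sinh 1))) at 2. now apply Rmult_le_compat_l. }
  exists (fun m => Re (b (2 * m)%nat)), d0; split.
  - set (h := fun th => sum_n (fun k => Re (b k) * cos (INR k * th)) (2 * d0 + 1)).
    assert (Hh : forall th, Rabs (cos (t * cos th) - h th) <= eps).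
    { intros th.
      assert (Hj : joukowski (cis th) = RtoC (cos th)).
      { unfold joukowski; rewrite cheb_lift_cis; simpl; f_equal; f_equal; ring. }
      pose proof (HP (RtoC (cos th))) as HE.
      rewrite <- Hj in HE at 4.
      rewrite (HF (2 * d0 + 1)%nat ltac:(lia) _ (cis_neq_0 th)) in HE.
      assert (Hc : Cmod (RtoC (cos th)) <= 2).
      { rewrite Cmod_R; apply Rle_trans with 1; [apply Rabs_le, COS_bound|lra]. }
      specialize (HE Hc).
      pose proof (Rle_trans _ _ _ (re_le_Cmod _) HE) as HE'.
      eapply Rle_trans; [right|exact HE'].
      f_equal. unfold Cminus.
      replace (((cexp (Ci * RtoC t * RtoC (cos th)) + cexp (- (Ci * RtoC t * RtoC (cos th)))) / 2)%C)
        with (RtoC (cos (t * cos th))).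
      - assert (Hs : Re (sum_n (fun k => b k * cheb_lift k (cis th))%C (2 * d0 + 1)) = h th).
        { rewrite Re_sum_n. apply sum_n_ext; intros k. rewrite cheb_lift_cis.
          rewrite Cmult_comm, Re_mult_R. apply Rmult_comm. }
        rewrite <- Hs. simpl. reflexivity.
      - unfold cexp.
        replace (Re (- (Ci * RtoC t * RtoC (cos th)))%C) with 0 by (simpl; ring).
        replace (Re (Ci * RtoC t * RtoC (cos th))%C) with 0 by (simpl; ring).
        replace (Im (- (Ci * RtoC t * RtoC (cos th)))%C) with (- (t * cos th)) by (simpl; ring).
        replace (Im (Ci * RtoC t * RtoC (cos th))%C) with (t * cos th) by (simpl; ring).
        rewrite exp_0, cos_neg, sin_neg.
        apply injective_projections; simpl; field. }
    intros th.
    replace (sum_n (fun m => Re (b (2 * m)%nat) * cos (2 * INR m * th)) d0)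
      with ((h th + h (PI - th)) / 2).
    + replace (cos (t * cos th) - (h th + h (PI - th)) / 2)
        with ((cos (t * cos th) - h th) / 2 + (cos (t * cos (PI - th)) - h (PI - th)) / 2).
      * eapply Rle_trans; [apply Rabs_triang|].
        unfold Rdiv; rewrite !Rabs_mult, (Rabs_pos_eq (/ 2)) by lra.
        pose proof (Hh th); pose proof (Hh (PI - th)); lra.
      * replace (cos (PI - th)) with (- cos th) by (rewrite Rtrigo_facts.cos_pi_minus; ring).
        replace (t * - cos th) with (- (t * cos th)) by ring. rewrite cos_neg; field.
    + unfold h; rewrite !sum_n_pairs.
      match goal with |- (?x + ?y) / 2 = _ => change ((x + y) / 2) with (mult (plus x y) (/ 2)) end.
      rewrite <- sum_n_plus.
      rewrite <- (sum_n_mult_r (K := R_Ring) (/ 2)). apply sum_n_ext; intros m.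
      change plus with Rplus; change mult with Rmult.
      rewrite !cos_nat_PI_minus, pow_add, pow_mult.
      replace ((-1) ^ 2) with 1 by ring. rewrite pow1, mult_INR. simpl INR.
      replace (1 + 1) with 2 by ring.
      R_eq. field.
  - intros m Hm.
    eapply Rle_trans; [apply re_le_Cmod|]. eapply Rle_trans; [apply Hb; lia|].
    right; unfold Rdiv; f_equal.
    rewrite pow_mult, <- pow_inv; f_equal.
    replace (-2) with (- (1 + 1)) by ring. rewrite exp_Ropp, exp_plus; f_equal; simpl; ring.
Qed.

(** * Integrals *)

Lemma four_sq_neq_1 (m : nat) : 1 - 4 * INR m ^ 2 <> 0.
Proof.
  intros H. assert (E : (4 * INR m ^ 2 = 1)%R) by lra.
  destruct m as [|m]; [simpl in E; lra|].
  rewrite S_INR in E. pose proof (pos_INR m). nra.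
Qed.

(** Half the integral of T_2m over [-1,1], after the substitution z = cos th. *)
Lemma is_RInt_cos_even (m : nat) :
  is_RInt (fun th => cos (2 * INR m * th) * (sin th / 2)) 0 PI (1 / (1 - 4 * INR m ^ 2)).
Proof.
  set (a := 2 * INR m).
  assert (N1 : a + 1 <> 0) by (unfold a; pose proof (pos_INR m); lra).
  assert (N2 : a - 1 <> 0).
  { intros H; apply (four_sq_neq_1 m). unfold a in H; nra. }
  set (G := fun th => - cos ((a + 1) * th) / (4 * (a + 1)) + cos ((a - 1) * th) / (4 * (a - 1))).
  replace (1 / (1 - 4 * INR m ^ 2)) with (minus (G PI) (G 0)).
  - apply (is_RInt_derive (V := R_CompleteNormedModule) G).
    + intros th _; unfold G. auto_derive; [tauto|].
      replace ((a + 1) * th) with (a * th + th) by ring.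
      replace ((a - 1) * th) with (a * th - th) by ring.
      rewrite sin_plus, sin_minus; field; split; assumption.
    + intros th _. apply continuity_pt_filterlim. unfold a; reg.
  - change minus with Rminus; unfold G. rewrite !Rmult_0_r, cos_0.
    assert (Hc : cos (a * PI) = 1).
    { unfold a. replace (2 * INR m * PI) with (0 + 2 * INR m * PI) by ring.
      rewrite cos_period; apply cos_0. }
    assert (Hs : sin (a * PI) = 0).
    { apply sin_eq_0_1. exists (2 * Z.of_nat m)%Z. unfold a. rewrite mult_IZR, <- INR_IZR_INZ. ring. }
    replace ((a + 1) * PI) with (a * PI + PI) by ring.
    replace ((a - 1) * PI) with (a * PI - PI) by ring.
    rewrite cos_plus, cos_minus, Hc, Hs, cos_PI.
    replace (1 - 4 * INR m ^ 2) with (- ((a - 1) * (a + 1))) by (unfold a; ring).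
    R_eq.
    field. repeat split; try assumption.
Qed.

(** Half the integral of cos(tz) over [-1,1], after the same substitution. *)
Lemma is_RInt_sinc (t : R) :
  is_RInt (fun th => cos (t * cos th) * (sin th / 2)) 0 PI (sinc t).
Proof.
  unfold sinc; destruct (Req_EM_T t 0) as [->|Ht].
  - apply is_RInt_ext with (fun th => sin th / 2).
    { intros th _; rewrite Rmult_0_l, cos_0; R_eq; field. }
    replace 1 with (minus (- cos PI / 2) (- cos 0 / 2))
      by (change minus with Rminus; rewrite cos_PI, cos_0; R_eq; field).
    apply (is_RInt_derive (V := R_CompleteNormedModule) (fun th => - cos th / 2)).
    + intros th _; auto_derive; [tauto|]; field.
    + intros th _; apply continuity_pt_filterlim; reg.
  - replace (sin t / t) with (minus (- sin (t * cos PI) / (2 * t)) (- sin (t * cos 0) / (2 * t))).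
    + apply (is_RInt_derive (V := R_CompleteNormedModule) (fun th => - sin (t * cos th) / (2 * t))).
      * intros th _; auto_derive; [tauto|]; field; assumption.
      * intros th _; apply continuity_pt_filterlim; reg.
    + change minus with Rminus; rewrite cos_PI, cos_0.
      replace (t * -1) with (- t) by ring. rewrite sin_neg, Rmult_1_r; R_eq; field; assumption.
Qed.

Lemma is_RInt_sum_n (f : nat -> R -> R) (I : nat -> R) (a b : R) (K : nat) :
  (forall m, is_RInt (f m) a b (I m)) ->
  is_RInt (fun x => sum_n (fun m => f m x) K) a b (sum_n I K).
Proof.
  intros H; induction K as [|K IH].
  - rewrite sum_O; eapply is_RInt_ext; [|apply (H O)]. intros; now rewrite sum_O.
  - rewrite sum_Sn; eapply is_RInt_ext; [|apply (is_RInt_plus (V := R_NormedModule)); [exact IH|apply (H (S K))]].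
    intros; now rewrite sum_Sn.
Qed.

(** * Discrete orthogonality and aliasing *)

(** The quadrature rule applied to T_2m. *)
Definition cc_cos (n m : nat) : R :=
  sum_n (fun k => cc_weight n k * cos (2 * INR m * (INR k * PI / INR n))) n.

Lemma sum_n_reflect (g : nat -> R) (p : nat) :
  (forall l, (l <= 2 * S p)%nat -> g (2 * S p - l)%nat = g l) ->
  sum_n g (2 * p + 1) + g 0%nat = sum_n g (S p) + sum_n g p.
Proof.
  intros Hg.
  assert (H : forall j, (j <= p)%nat ->
     sum_n g (S p + j) + sum_n g (p - j) = sum_n g (S p) + sum_n g p).
  { induction j as [|j IH]; intros Hj.
    - rewrite Nat.add_0_r, Nat.sub_0_r; reflexivity.
    - rewrite <- IH by lia.
      replace (S p + S j)%nat with (S (S p + j)) by lia. rewrite (sum_Sn g (S p + j)).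
      replace (p - j)%nat with (S (p - S j)) by lia. rewrite (sum_Sn g (p - S j)).
      rewrite <- (Hg (S (p - S j))) by lia.
      replace (2 * S p - S (p - S j))%nat with (S (S p + j)) by lia.
      change plus with Rplus. lra. }
  rewrite <- (H p (le_n _)), Nat.sub_diag, sum_O.
  do 2 f_equal; lia.
Qed.

Lemma eps_sq_end (n k : nat) : k = 0%nat \/ k = n -> eps n k ^ 2 = 1 / 2.
Proof.
  intros H; unfold eps.
  replace (Nat.eqb k 0 || Nat.eqb k n)%bool with true.
  - unfold Rdiv; rewrite Rpow_mult_distr, pow2_sqrt by lra; field.
  - symmetry; apply Bool.orb_true_iff; rewrite !Nat.eqb_eq; exact H.
Qed.

Lemma eps_sq_interior (n k : nat) : k <> 0%nat -> k <> n -> eps n k ^ 2 = 1.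
Proof.
  intros H1 H2; unfold eps.
  apply Nat.eqb_neq in H1, H2; rewrite H1, H2; simpl; ring.
Qed.

(** The weights [eps n k ^ 2] are those of the trapezoidal rule on [0, PI];
    reflecting it gives the plain sum over a full period of 2n points. *)
Lemma trapezoid_sum (g : nat -> R) (p : nat) :
  (forall l, (l <= 2 * S p)%nat -> g (2 * S p - l)%nat = g l) ->
  2 * sum_n (fun k => eps (S p) k ^ 2 * g k) (S p) = sum_n g (2 * p + 1).
Proof.
  intros Hg; pose proof (sum_n_reflect g p Hg) as HR.
  assert (H : forall j, (j <= p)%nat ->
     sum_n (fun k => eps (S p) k ^ 2 * g k) j = sum_n g j - g 0%nat / 2).
  { induction j as [|j IH]; intros Hj.
    - rewrite !sum_O, eps_sq_end by auto; lra.
    - rewrite !sum_Sn, IH, eps_sq_interior by lia. change plus with Rplus; lra. }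
  rewrite sum_Sn, (H p (le_n _)), eps_sq_end by auto.
  rewrite sum_Sn in HR. change plus with Rplus in *. lra.
Qed.

Lemma cos_node_reflect (p : nat) (z : Z) (l : nat) : (l <= 2 * S p)%nat ->
  cos (IZR z * (INR (2 * S p - l) * PI / INR (S p))) = cos (IZR z * (INR l * PI / INR (S p))).
Proof.
  intros Hl; rewrite minus_INR, mult_INR by assumption; simpl (INR 2).
  assert (HL : INR (S p) <> 0) by (apply not_0_INR; lia).
  replace (IZR z * (((1 + 1) * INR (S p) - INR l) * PI / INR (S p)))
    with (2 * (IZR z * PI) - IZR z * (INR l * PI / INR (S p))) by (field; assumption).
  rewrite cos_minus, sin_2a, cos_2a_sin, (sin_eq_0_1 (IZR z * PI)) by (now exists z). ring.
Qed.

Lemma trapezoid_cos_zero (p : nat) (z : Z) :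
  (forall q : Z, z <> q * Z.of_nat (2 * S p))%Z ->
  sum_n (fun k => eps (S p) k ^ 2 * cos (IZR z * (INR k * PI / INR (S p)))) (S p) = 0.
Proof.
  intros Hz.
  apply Rmult_eq_reg_l with 2; [|lra]. rewrite Rmult_0_r.
  rewrite (trapezoid_sum (fun k => cos (IZR z * (INR k * PI / INR (S p)))))
    by (intros l Hl; now apply cos_node_reflect).
  pose proof (cis_sum z (2 * p + 1)) as H.
  replace (S (2 * p + 1)) with (2 * S p)%nat in H by lia.
  specialize (H Hz). apply (f_equal Re) in H.
  rewrite Re_sum_n in H; simpl (Re (RtoC 0)) in H. rewrite <- H.
  apply sum_n_ext; intros l; match goal with |- _ = Re (cis ?x) => change (Re (cis x)) with (cos x) end; f_equal.
  rewrite mult_INR; simpl (INR 2).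
  assert (HL : INR (S p) <> 0) by (apply not_0_INR; lia). field; assumption.
Qed.

Lemma trapezoid_cos_full (p : nat) (q : Z) :
  sum_n (fun k => eps (S p) k ^ 2 *
     cos (IZR (q * Z.of_nat (2 * S p)) * (INR k * PI / INR (S p)))) (S p) = INR (S p).
Proof.
  apply Rmult_eq_reg_l with 2; [|lra].
  rewrite (trapezoid_sum (fun k => cos (IZR (q * Z.of_nat (2 * S p)) * (INR k * PI / INR (S p)))))
    by (intros l Hl; now apply cos_node_reflect).
  rewrite (sum_n_ext _ (fun _ => 1)).
  - rewrite sum_n_const. replace (S (2 * p + 1)) with (2 * S p)%nat by lia.
    rewrite mult_INR; simpl (INR 2); ring.
  - intros l. rewrite mult_IZR, <- INR_IZR_INZ, mult_INR; simpl (INR 2).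
    assert (HL : INR (S p) <> 0) by (apply not_0_INR; lia).
    replace (IZR q * ((1 + 1) * INR (S p)) * (INR l * PI / INR (S p)))
      with (2 * (IZR (q * Z.of_nat l) * PI))
      by (rewrite mult_IZR, <- INR_IZR_INZ; field; assumption).
    rewrite cos_2a_sin, sin_eq_0_1; [R_eq; ring|]. now exists (q * Z.of_nat l)%Z.
Qed.

(** The weights are themselves cosine sums, so the rule applied to T_2m is a
    combination of trapezoidal sums of products of two cosines. *)
Lemma cc_cos_expand (p m : nat) :
  cc_cos (S p) m =
  sum_n (fun j => eps (S p) (2 * j) ^ 2 * (2 / (1 - 4 * INR j ^ 2)) * / INR (S p) *
    ((sum_n (fun k => eps (S p) k ^ 2 *
        cos (IZR (2 * (Z.of_nat j - Z.of_nat m)) * (INR k * PI / INR (S p)))) (S p)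
     + sum_n (fun k => eps (S p) k ^ 2 *
        cos (IZR (2 * (Z.of_nat j + Z.of_nat m)) * (INR k * PI / INR (S p)))) (S p)) / 2))
    (Nat.div (S p) 2).
Proof.
  unfold cc_cos, cc_weight.
  set (n := S p).
  assert (HL : INR n <> 0) by (apply not_0_INR; unfold n; lia).
  set (u := fun j k : nat => eps n (2 * j) ^ 2 * (2 / (1 - 4 * INR j ^ 2)) * / INR n *
     (eps n k ^ 2 * cos (IZR (2 * (Z.of_nat j - Z.of_nat m)) * (INR k * PI / INR n))
    + eps n k ^ 2 * cos (IZR (2 * (Z.of_nat j + Z.of_nat m)) * (INR k * PI / INR n))) / 2).
  transitivity (sum_n (fun k => sum_n (fun j => u j k) (Nat.div n 2)) n).
  - apply sum_n_ext; intros k.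
    match goal with |- 1 / INR n * ?a * sum_n ?f ?N * ?c = _ =>
      transitivity (mult (mult (1 / INR n * a) (sum_n f N)) c); [reflexivity|] end.
    rewrite <- (sum_n_mult_l (K := R_Ring)), <- (sum_n_mult_r (K := R_Ring)).
    apply sum_n_ext; intros j. change mult with Rmult. unfold u.
    rewrite !mult_IZR, minus_IZR, plus_IZR, <- !INR_IZR_INZ.
    set (x := INR k * PI / INR n).
    replace (2 * INR j * INR k * PI / INR n) with (2 * INR j * x) by (unfold x; field; assumption).
    replace (2 * (INR j - INR m) * x) with (2 * INR j * x - 2 * INR m * x) by ring.
    replace (2 * (INR j + INR m) * x) with (2 * INR j * x + 2 * INR m * x) by ring.
    rewrite cos_minus, cos_plus.
    R_eq.
    pose proof (four_sq_neq_1 j). field; split; assumption.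
  - rewrite sum_n_switch. apply sum_n_ext; intros j. unfold u.
    set (A := eps n (2 * j) ^ 2 * (2 / (1 - 4 * INR j ^ 2)) * / INR n).
    match goal with |- _ = A * ((?x + ?y) / 2) =>
      transitivity (mult (A / 2) (plus x y)); [|change mult with Rmult; change plus with Rplus;
       R_eq; field] end.
    rewrite <- sum_n_plus, <- (sum_n_mult_l (K := R_Ring)).
    apply sum_n_ext; intros k. change mult with Rmult; change plus with Rplus.
    R_eq. field.
Qed.

(** By orthogonality only the summand j = m survives.  For m = 0 and 2m = n both
    the sum and the difference frequency resonate, and the factor
    [eps n (2 * m) ^ 2 = 1 / 2] compensates exactly. *)
Lemma cc_cos_low (n m : nat) : (1 <= n)%nat -> (2 * m <= n)%nat ->
  cc_cos n m = 1 / (1 - 4 * INR m ^ 2).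
Proof.
  destruct n as [|p]; [lia|]; intros _ Hm. rewrite cc_cos_expand.
  assert (HL : INR (S p) <> 0) by (apply not_0_INR; lia).
  pose proof (four_sq_neq_1 m) as H4.
  assert (HD : (m <= Nat.div (S p) 2)%nat) by (apply Nat.div_le_lower_bound; lia).
  rewrite (sum_n_single _ _ m HD).
  - rewrite Z.sub_diag. change (2 * 0)%Z with (0 * Z.of_nat (2 * S p))%Z.
    rewrite trapezoid_cos_full.
    destruct (Nat.eq_dec m 0) as [->|Hm0]; [|destruct (Nat.eq_dec (2 * m) (S p)) as [e|Hme]].
    + change (2 * (Z.of_nat 0 + Z.of_nat 0))%Z with (0 * Z.of_nat (2 * S p))%Z.
      rewrite trapezoid_cos_full, eps_sq_end by auto. field; split; assumption.
    + replace (2 * (Z.of_nat m + Z.of_nat m))%Z with (1 * Z.of_nat (2 * S p))%Z by lia.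
      rewrite trapezoid_cos_full, eps_sq_end by auto. field; split; assumption.
    + rewrite eps_sq_interior by lia. rewrite trapezoid_cos_zero; [field; split; assumption|].
      intros q E. assert (q <= 0 \/ 0 < q)%Z as [h|h] by lia; nia.
  - intros j Hj Hne.
    assert (2 * j <= S p)%nat by (pose proof (Nat.div_mod (S p) 2); lia).
    rewrite !trapezoid_cos_zero; [change zero with 0; R_eq; field; split; [assumption|apply four_sq_neq_1]| |].
    + intros q E. assert (q < 0 \/ q = 0 \/ 0 < q)%Z as [h|[h|h]] by lia; nia.
    + intros q E. assert (q < 0 \/ q = 0 \/ 0 < q)%Z as [h|[h|h]] by lia; nia.
Qed.

Lemma cc_cos_shift (n q m : nat) : (1 <= n)%nat -> cc_cos n (q * n + m) = cc_cos n m.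
Proof.
  intros Hn; apply sum_n_ext; intros k; f_equal.
  assert (HL : INR n <> 0) by (apply not_0_INR; lia).
  rewrite <- (cos_period (2 * INR m * (INR k * PI / INR n)) (q * k)).
  f_equal. rewrite plus_INR, !mult_INR; field; assumption.
Qed.

Lemma cc_cos_reflect (n q m : nat) : (1 <= n)%nat -> (m <= q * n)%nat ->
  cc_cos n (q * n - m) = cc_cos n m.
Proof.
  intros Hn Hm; apply sum_n_ext; intros k; f_equal.
  assert (HL : INR n <> 0) by (apply not_0_INR; lia).
  rewrite <- (cos_neg (2 * INR m * _)).
  rewrite <- (cos_period (- (2 * INR m * (INR k * PI / INR n))) (q * k)).
  f_equal. rewrite minus_INR, !mult_INR by assumption; field; assumption.
Qed.

(** T_2k agrees at the nodes with T_2m, where m is the distance from k to the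
    nearest multiple of n. *)
Lemma cc_cos_alias (n k : nat) : (1 <= n)%nat ->
  exists m, (2 * m <= n)%nat /\ cc_cos n k = 1 / (1 - 4 * INR m ^ 2).
Proof.
  intros Hn.
  pose proof (Nat.div_mod k n ltac:(lia)) as E.
  pose proof (Nat.mod_upper_bound k n ltac:(lia)) as Hr.
  set (q := Nat.div k n) in *; set (r := Nat.modulo k n) in *.
  destruct (le_lt_dec (2 * r) n) as [h|h].
  - exists r; split; [assumption|].
    rewrite <- (cc_cos_low n r Hn h), <- (cc_cos_shift n q r Hn). f_equal; lia.
  - exists (n - r)%nat; split; [lia|].
    rewrite <- (cc_cos_low n (n - r) Hn), <- (cc_cos_reflect n (S q) (n - r) Hn) by lia.
    f_equal; simpl; lia.
Qed.

(** * Numerical bounds *)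

Lemma exp_1_bounds : 2.717 <= exp 1 <= 2.719.
Proof.
  split.
  - eapply Rle_trans; [|apply (exp_ge_taylor 1 6); lra]. simpl; lra.
  - destruct (Taylor_Lagrange exp 6 0 1 ltac:(lra)) as (z & Hz & ->).
    { intros t _ k _; destruct k; [exact I|].
      eexists; apply (is_derive_n_exp (S k)). }
    assert (Hd : forall k x, Derive_n exp k x = exp x)
      by (intros k x; apply is_derive_n_unique, is_derive_n_exp).
    rewrite Hd.
    rewrite (sum_eq _ (fun m => (1 - 0) ^ m / INR (Factorial.fact m)))
      by (intros i _; rewrite Hd, exp_0; ring).
    assert (exp z <= 3).
    { eapply Rle_trans; [|apply exp_le_3]; left; apply exp_increasing; lra. }
    simpl; lra.
Qed.

Lemma PI_bounds : 3.141 <= PI <= 3.1425.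
Proof.
  destruct (PI_2_3_7_ineq 1) as [l u].
  unfold tg_alt, PI_2_3_7_tg, Ratan_seq in l, u; simpl in l, u. lra.
Qed.

Lemma threshold_sinh : threshold = PI * sinh 1.
Proof.
  unfold threshold, sinh; rewrite exp_Ropp.
  pose proof (exp_pos 1); field; lra.
Qed.

Lemma threshold_bounds : 3.686 <= threshold <= 3.6947.
Proof.
  unfold threshold.
  pose proof exp_1_bounds as [e1 e2]. pose proof PI_bounds as [p1 p2].
  set (e := exp 1) in *.
  assert (e0 : 0 < 2 * e) by lra.
  assert (s1 : 1.174 * (2 * e) <= e ^ 2 - 1) by nra.
  assert (s2 : e ^ 2 - 1 <= 1.1757 * (2 * e)) by nra.
  assert (E : PI * (e ^ 2 - 1) / (2 * e) * (2 * e) = PI * (e ^ 2 - 1)) by (field; lra).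
  set (w := e ^ 2 - 1) in *.
  split; apply Rmult_le_reg_r with (2 * e); try assumption; rewrite E; nra.
Qed.

(** * The quadrature error on Chebyshev polynomials *)

Definition cc_defect (n k : nat) : R := 1 / (1 - 4 * INR k ^ 2) - cc_cos n k.

Lemma inv_one_minus_four_sq_bounds (a m : nat) : (1 <= a)%nat -> (a <= m)%nat ->
  1 / (1 - 4 * INR a ^ 2) <= 1 / (1 - 4 * INR m ^ 2) <= 0.
Proof.
  intros H1 H2; apply le_INR in H1, H2; simpl (INR 1) in H1.
  replace (1 / (1 - 4 * INR a ^ 2)) with (- (/ (4 * INR a ^ 2 - 1))) by (field; nra).
  replace (1 / (1 - 4 * INR m ^ 2)) with (- (/ (4 * INR m ^ 2 - 1))) by (field; nra).
  assert (0 < / (4 * INR m ^ 2 - 1)) by (apply Rinv_0_lt_compat; nra).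
  assert (/ (4 * INR m ^ 2 - 1) <= / (4 * INR a ^ 2 - 1)) by (apply Rinv_le_contravar; nra).
  lra.
Qed.

Lemma cc_defect_zero (n k : nat) : (1 <= n)%nat -> (2 * k <= n)%nat -> cc_defect n k = 0.
Proof. intros Hn Hk; unfold cc_defect; rewrite cc_cos_low by assumption; ring. Qed.

Lemma cc_cos_bounds (n k : nat) : (1 <= n)%nat -> - (1 / 3) <= cc_cos n k <= 1.
Proof.
  intros Hn; destruct (cc_cos_alias n k Hn) as (m & _ & ->).
  destruct m as [|m].
  - simpl; lra.
  - pose proof (inv_one_minus_four_sq_bounds 1 (S m) ltac:(lia) ltac:(lia)) as H.
    simpl (INR 1) in H. lra.
Qed.

Lemma cc_defect_le (n k : nat) : (1 <= n)%nat -> (3 <= k)%nat -> Rabs (cc_defect n k) <= 36 / 35.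
Proof.
  intros Hn Hk; unfold cc_defect.
  pose proof (cc_cos_bounds n k Hn).
  pose proof (inv_one_minus_four_sq_bounds 3 k ltac:(lia) Hk) as H2.
  simpl (INR 3) in H2. apply Rabs_le; lra.
Qed.

(** In degree n + 1 = 2q + 2 the aliased degree is n - 1 = 2q, so the defect is
    1/(4q^2 - 1) - 1/(4(q+1)^2 - 1), which is largest for q = 1. *)
Lemma cc_defect_first_odd (q : nat) : (1 <= q)%nat ->
  Rabs (cc_defect (2 * q + 1) (q + 1)) <= 4 / 15.
Proof.
  intros Hq; unfold cc_defect.
  replace (cc_cos (2 * q + 1) (q + 1)) with (cc_cos (2 * q + 1) (1 * (2 * q + 1) - q))
    by (f_equal; lia).
  rewrite cc_cos_reflect, cc_cos_low by lia.
  destruct (Nat.eq_dec q 1) as [->|Hq1].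
  - simpl; apply Rabs_le; lra.
  - pose proof (inv_one_minus_four_sq_bounds 2 q ltac:(lia) ltac:(lia)) as H1.
    pose proof (inv_one_minus_four_sq_bounds 2 (q + 1) ltac:(lia) ltac:(lia)) as H2.
    simpl (INR 2) in H1, H2. apply Rabs_le; lra.
Qed.

Lemma cc_defect_2_2 : Rabs (cc_defect 2 2) = 16 / 15.
Proof.
  unfold cc_defect; change (cc_cos 2 2) with (cc_cos 2 (1 * 2 + 0)).
  rewrite cc_cos_shift, cc_cos_low by lia.
  simpl; rewrite Rabs_left; lra.
Qed.

Lemma cc_defect_2_3 : Rabs (cc_defect 2 3) <= 1 / 3.
Proof.
  unfold cc_defect; change (cc_cos 2 3) with (cc_cos 2 (1 * 2 + 1)).
  rewrite cc_cos_shift, cc_cos_low by lia.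
  simpl; apply Rabs_le; lra.
Qed.

Lemma sum_n_geometric_tail (a : nat -> R) (A y : R) (k0 K : nat) :
  0 <= y < 1 -> 0 <= A -> (forall k, 0 <= a k) ->
  (forall k, (k0 < k)%nat -> a k <= A * y ^ k) ->
  sum_n a K <= sum_n a k0 + A * (y ^ S k0 / (1 - y)).
Proof.
  intros Hy HA H0 Ha.
  assert (Hpos : forall k, 0 <= A * (y ^ k / (1 - y))).
  { intros k; apply Rmult_le_pos; [assumption|]. apply Rdiv_le_0_compat; [apply pow_le|]; lra. }
  destruct (le_lt_dec K k0) as [h|h].
  - apply Rle_trans with (sum_n a k0); [|pose proof (Hpos (S k0)); lra].
    clear Ha; induction h as [|k h IH]; [lra|].
    rewrite sum_Sn; change plus with Rplus; pose proof (H0 (S k)); lra.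
  - assert (H : forall j, sum_n a (k0 + j) <=
                sum_n a k0 + A * ((y ^ S k0 - y ^ S (k0 + j)) / (1 - y))).
    { induction j as [|j IH].
      - rewrite Nat.add_0_r. replace (y ^ S k0 - y ^ S k0) with 0 by ring; unfold Rdiv; rewrite Rmult_0_l, Rmult_0_r, Rplus_0_r; apply Rle_refl.
      - replace (k0 + S j)%nat with (S (k0 + j)) by lia.
        rewrite sum_Sn; change plus with Rplus.
        pose proof (Ha (S (k0 + j)) ltac:(lia)).
        replace ((y ^ S k0 - y ^ S (S (k0 + j))) / (1 - y))
          with ((y ^ S k0 - y ^ S (k0 + j)) / (1 - y) + y ^ S (k0 + j))
          by (simpl; field; lra).
        lra. }
    replace K with (k0 + (K - k0))%nat by lia.
    eapply Rle_trans; [apply H|].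
    pose proof (Hpos (S (k0 + (K - k0)))).
    unfold Rdiv in *; rewrite Rmult_minus_distr_r. lra.
Qed.

Lemma exp_neg_nat (n : nat) : exp (- INR n) = exp (- (1)) ^ n.
Proof.
  induction n as [|n IH]; [simpl; rewrite Ropp_0; apply exp_0|].
  rewrite S_INR, Ropp_plus_distr, exp_plus, IH; simpl; ring.
Qed.

(** The three cases n = 2, n = 2q >= 4 and n = 2q + 1 differ in which of the
    leading terms are split off before the geometric tail is bounded by the
    uniform constant 36/35.  With x = 1/e, the odd case reduces to
    4/15 <= (36/35) x/(1 + x), that is x >= 0.3501; the case n = 2 to
    4/105 <= (73/105) x^2. *)
Lemma cc_defect_sum_bound (n K : nat) : (2 <= n)%nat ->
  sum_n (fun k => Rabs (cc_defect n k) * exp (-2) ^ k) K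
  <= 36 / (35 * (exp 1 ^ 2 - 1)) * exp (- INR n).
Proof.
  intros Hn.
  pose proof exp_1_bounds as [e1 e2].
  set (x := exp (- (1))).
  assert (Hx : x = / exp 1) by apply exp_Ropp.
  assert (Hxb : 0.36 <= x <= 0.37).
  { rewrite Hx; split.
    - apply Rmult_le_reg_r with (exp 1); [lra|]; rewrite Rinv_l; lra.
    - apply Rmult_le_reg_r with (exp 1); [lra|]; rewrite Rinv_l; lra. }
  set (y := x ^ 2).
  assert (Hy : exp (-2) = y).
  { unfold y, x. replace (-2) with (- INR 2) by (simpl; ring). apply exp_neg_nat. }
  assert (Hyb : 0.1296 <= y <= 0.1369) by (unfold y; nra).
  rewrite exp_neg_nat; fold x. rewrite Hy.
  replace (36 / (35 * (exp 1 ^ 2 - 1))) with (36 / 35 * (y / (1 - y))).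
  2:{ unfold y; rewrite Hx; field; split; nra. }
  set (a := fun k => Rabs (cc_defect n k) * y ^ k).
  assert (Hyk : forall k, 0 < y ^ k) by (intros k; apply pow_lt; lra).
  assert (Ha0 : forall k, 0 <= a k).
  { intros k; apply Rmult_le_pos; [apply Rabs_pos|left; apply Hyk]. }
  assert (Ha : forall k, (3 <= k)%nat -> a k <= 36 / 35 * y ^ k).
  { intros k Hk; apply Rmult_le_compat_r; [left; apply Hyk|]. apply cc_defect_le; lia. }
  assert (Hz : forall k, (2 * k <= n)%nat -> a k = 0).
  { intros k Hk; unfold a; rewrite cc_defect_zero by lia; rewrite Rabs_R0; ring. }
  assert (Hzs : forall k, (2 * k <= n)%nat -> sum_n a k = 0).
  { intros k Hk; apply (sum_n_zero a k); intros j Hj; apply Hz; lia. }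
  destruct (Nat.Even_or_Odd n) as [[q Eq]|[q Eq]].
  - destruct (Nat.eq_dec q 1) as [->|Hq1].
    + subst n.
      eapply Rle_trans; [apply (sum_n_geometric_tail a (36 / 35) y 3); try lra; try assumption|].
      { intros k Hk; apply Ha; lia. }
      rewrite (sum_Sn a 2), (sum_Sn a 1), (Hzs 1%nat) by lia. change plus with Rplus.
      pose proof cc_defect_2_2 as H2; pose proof cc_defect_2_3 as H3.
      unfold a; simpl (2 * 1)%nat; rewrite H2.
      fold y.
      assert (Rabs (cc_defect 2 3) * y ^ 3 <= 1 / 3 * y ^ 3)
        by (apply Rmult_le_compat_r; [left; apply Hyk|assumption]).
      assert (E : 36 / 35 * (y / (1 - y)) * y
                  = 36 / 35 * y ^ 2 + 36 / 35 * y ^ 3 + 36 / 35 * (y ^ 4 / (1 - y)))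
        by (field; lra).
      rewrite E.
      assert (16 / 15 * y ^ 2 + 1 / 3 * y ^ 3 <= 36 / 35 * y ^ 2 + 36 / 35 * y ^ 3).
      { simpl; nra. }
      lra.
    + eapply Rle_trans; [apply (sum_n_geometric_tail a (36 / 35) y q); try lra; try assumption|].
      { intros k Hk; apply Ha; lia. }
      rewrite Hzs by lia.
      rewrite Eq, pow_mult; fold y.
      right; simpl; field; lra.
  - eapply Rle_trans; [apply (sum_n_geometric_tail a (36 / 35) y (q + 1)); try lra; try assumption|].
    { intros k Hk; apply Ha; lia. }
    replace (q + 1)%nat with (S q) by lia.
    rewrite sum_Sn, Hzs by lia. change plus with Rplus.
    assert (a (S q) <= 4 / 15 * y ^ S q).
    { unfold a; apply Rmult_le_compat_r; [left; apply Hyk|].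
      rewrite Eq; replace (S q) with (q + 1)%nat by lia. apply cc_defect_first_odd; lia. }
    rewrite Eq, pow_add, pow_mult, pow_1; fold y.
    assert (E : 36 / 35 * (y / (1 - y)) * (y ^ q * x)
                - (4 / 15 * y ^ S q + 36 / 35 * (y ^ S (S q) / (1 - y)))
              = y ^ S q * (36 / 35 * (x / (1 + x)) - 4 / 15)).
    { simpl; unfold y. field. split; [lra|]. fold y; lra. }
    assert (Hpos : 0 <= y ^ S q * (36 / 35 * (x / (1 + x)) - 4 / 15)).
    { apply Rmult_le_pos; [left; apply Hyk|].
      assert (4 / 15 * (35 / 36) <= x / (1 + x)); [|lra].
      apply Rmult_le_reg_r with (1 + x); [lra|].
      replace (x / (1 + x) * (1 + x)) with x by (field; lra). lra. }
    lra.
Qed.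

(** * The quadrature error of the cosine *)

(** Replacing cos(tz) by its eps-approximation changes the integral by at most
    PI eps and the quadrature sum by at most W eps, where W is the sum of the
    absolute weights; both vanish with eps. *)
Lemma cc_error_bound (n : nat) (t : R) : (2 <= n)%nat ->
  Rabs (sinc t - sum_n (fun k => cc_weight n k * cos (t * cheb_point n k)) n)
  <= 2 * cosh (t * sinh 1) * (36 / (35 * (exp 1 ^ 2 - 1)) * exp (- INR n)).
Proof.
  intros Hn.
  set (S0 := 36 / (35 * (exp 1 ^ 2 - 1)) * exp (- INR n)).
  assert (HS0 : 0 <= S0).
  { eapply Rle_trans; [|apply (cc_defect_sum_bound n 0 Hn)]. rewrite sum_O; simpl.
    rewrite Rmult_1_r; apply Rabs_pos. }
  set (W := sum_n (fun k => Rabs (cc_weight n k)) n).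
  assert (HW : 0 <= W).
  { eapply Rle_trans; [apply Rabs_pos|apply (Rabs_sum_n_le (cc_weight n) n)]. }
  pose proof PI_RGT_0 as Hpi.
  set (X := Rabs _).
  set (k0 := 2 * S0 + PI + W).
  assert (Hk0 : 0 < k0) by (unfold k0; lra).
  apply Rnot_lt_le; intros Hlt.
  (* If the bound failed, an eps taking up only half of the excess would
     contradict the estimate [H]. *)
  set (eps := (X - 2 * cosh (t * sinh 1) * S0) / (2 * k0)).
  assert (He : 0 < eps) by (apply Rdiv_lt_0_compat; lra).
  assert (H : X <= 2 * cosh (t * sinh 1) * S0 + k0 * eps).
  2:{ replace (k0 * eps) with ((X - 2 * cosh (t * sinh 1) * S0) / 2) in H
        by (unfold eps; field; lra). lra. }
  clearbody eps. unfold X.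
  destruct (cos_cheb_approx t eps He) as (c & K & Happ & Hc).
  set (g := fun th => sum_n (fun m => c m * cos (2 * INR m * th)) K).
  assert (HI : is_RInt (fun th => g th * (sin th / 2)) 0 PI
                 (sum_n (fun m => c m * (1 / (1 - 4 * INR m ^ 2))) K)).
  { eapply is_RInt_ext;
      [|apply (is_RInt_sum_n (fun m th => scal (c m) (cos (2 * INR m * th) * (sin th / 2)))
           (fun m => scal (c m) (1 / (1 - 4 * INR m ^ 2))));
        intros m; apply (is_RInt_scal (V := R_NormedModule)), is_RInt_cos_even].
    intros th _; unfold g.
    rewrite <- (sum_n_mult_r (K := R_Ring) (sin th / 2)).
    apply sum_n_ext; intros m. symmetry. apply Rmult_assoc. }
  assert (HI' : Rabs (sinc t - sum_n (fun m => c m * (1 / (1 - 4 * INR m ^ 2))) K) <= PI * eps).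
  { replace (PI * eps) with ((PI - 0) * eps) by ring.
    apply (norm_RInt_le_const (V := R_NormedModule)
      (fun th => minus (cos (t * cos th) * (sin th / 2)) (g th * (sin th / 2))) 0 PI); [lra| |].
    - intros th _.
      change (Rabs (cos (t * cos th) * (sin th / 2) - g th * (sin th / 2)) <= eps).
      rewrite <- Rmult_minus_distr_r, Rabs_mult.
      apply Rle_trans with (eps * 1); [|lra].
      apply Rmult_le_compat; try apply Rabs_pos; [apply Happ|].
      pose proof (SIN_bound th); apply Rabs_le; lra.
    - apply (is_RInt_minus (V := R_NormedModule)); [apply is_RInt_sinc|exact HI]. }
  assert (HQ : Rabs (sum_n (fun k => cc_weight n k * cos (t * cheb_point n k)) n
                 - sum_n (fun m => c m * cc_cos n m) K) <= W * eps).
  { replace (sum_n (fun m => c m * cc_cos n m) K)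
      with (sum_n (fun k => cc_weight n k * g (INR k * PI / INR n)) n).
    - replace (sum_n (fun k => cc_weight n k * cos (t * cheb_point n k)) n
          - sum_n (fun k => cc_weight n k * g (INR k * PI / INR n)) n)
        with (sum_n (fun k => cc_weight n k * (cos (t * cheb_point n k) - g (INR k * PI / INR n))) n).
      + eapply Rle_trans; [apply Rabs_sum_n_le|]. unfold W.
        rewrite <- (sum_n_mult_r (K := R_Ring) eps). apply sum_n_le; intros k _.
        rewrite Rabs_mult. apply Rmult_le_compat_l; [apply Rabs_pos|]. apply Happ.
      + assert (Hminus : forall (u v : nat -> R) N,
            sum_n (fun k => u k - v k) N = sum_n u N - sum_n v N).
        { intros u v N; induction N as [|N IH]; [now rewrite !sum_O|].
          rewrite !sum_Sn, IH; change plus with Rplus; R_eq; ring. }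
        rewrite <- Hminus; apply sum_n_ext; intros k; R_eq; ring.
    - unfold g, cc_cos.
      transitivity (sum_n (fun k => sum_n (fun m =>
         c m * (cc_weight n k * cos (2 * INR m * (INR k * PI / INR n)))) K) n).
      + apply sum_n_ext; intros k. rewrite <- (sum_n_mult_l (K := R_Ring) (cc_weight n k)).
        apply sum_n_ext; intros m; change mult with Rmult; R_eq; ring.
      + rewrite sum_n_switch; apply sum_n_ext; intros m. apply (sum_n_mult_l (K := R_Ring)). }
  assert (HE : Rabs (sum_n (fun m => c m * (1 / (1 - 4 * INR m ^ 2))) K
                     - sum_n (fun m => c m * cc_cos n m) K)
               <= 2 * (cosh (t * sinh 1) + eps) * S0).
  { assert (Hch : 0 <= cosh (t * sinh 1)).
    { unfold cosh; pose proof (exp_pos (t * sinh 1)); pose proof (exp_pos (- (t * sinh 1))); lra. }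
    replace (sum_n (fun m => c m * (1 / (1 - 4 * INR m ^ 2))) K - sum_n (fun m => c m * cc_cos n m) K)
      with (sum_n (fun m => c m * cc_defect n m) K).
    - eapply Rle_trans; [apply Rabs_sum_n_le|].
      apply Rle_trans with (2 * (cosh (t * sinh 1) + eps) *
         sum_n (fun k => Rabs (cc_defect n k) * exp (-2) ^ k) K).
      + rewrite <- (sum_n_mult_l (K := R_Ring)). apply sum_n_le; intros m _.
        change mult with Rmult. rewrite Rabs_mult.
        destruct m as [|m].
        * rewrite cc_defect_zero, Rabs_R0 by lia. right; ring.
        * pose proof (Hc (S m) ltac:(lia)) as Hcm. pose proof (Rabs_pos (cc_defect n (S m))).
          rewrite (Rmult_comm (Rabs (cc_defect n (S m)))), <- Rmult_assoc.
          now apply Rmult_le_compat_r.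
      + apply Rmult_le_compat_l; [lra|]. now apply cc_defect_sum_bound.
    - clear. induction K as [|K IH].
      + rewrite !sum_O; unfold cc_defect; R_eq; ring.
      + rewrite !sum_Sn, IH; unfold cc_defect; change plus with Rplus; R_eq; ring. }
  unfold k0.
  match goal with |- Rabs (?s - ?q) <= _ =>
    match type of HE with Rabs (?i - ?j) <= _ =>
      replace (s - q) with ((s - i) + (i - j) + - (q - j)) by ring end end.
  eapply Rle_trans; [apply Rabs_triang|]. rewrite Rabs_Ropp.
  eapply Rle_trans; [apply Rplus_le_compat_r, Rabs_triang|]. nra.
Qed.

(** * Reduction to the cosine and conclusion *)

Lemma cc_weight_reflect (n k : nat) : (1 <= n)%nat -> (k <= n)%nat ->
  cc_weight n (n - k) = cc_weight n k.
Proof.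
  intros Hn Hk; unfold cc_weight.
  assert (HL : INR n <> 0) by (apply not_0_INR; lia).
  replace (eps n (n - k)) with (eps n k).
  - f_equal; apply sum_n_ext; intros j; f_equal.
    rewrite minus_INR by assumption.
    rewrite <- (cos_neg (2 * INR j * INR k * PI / INR n)).
    rewrite <- (cos_period (- (2 * INR j * INR k * PI / INR n)) j).
    f_equal; field; assumption.
  - unfold eps. replace (Nat.eqb (n - k) 0) with (Nat.eqb k n).
    + replace (Nat.eqb (n - k) n) with (Nat.eqb k 0); [now rewrite Bool.orb_comm|].
      destruct (Nat.eqb_spec k 0), (Nat.eqb_spec (n - k) n); lia || reflexivity.
    + destruct (Nat.eqb_spec k n), (Nat.eqb_spec (n - k) 0); lia || reflexivity.
Qed.

Lemma cheb_point_reflect (n k : nat) : (1 <= n)%nat -> (k <= n)%nat ->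
  cheb_point n (n - k) = - cheb_point n k.
Proof.
  intros Hn Hk; unfold cheb_point.
  assert (HL : INR n <> 0) by (apply not_0_INR; lia).
  rewrite <- Rtrigo_facts.cos_pi_minus; f_equal.
  rewrite minus_INR by assumption; field; assumption.
Qed.

Lemma cc_sin_zero (n : nat) (t : R) : (1 <= n)%nat ->
  sum_n (fun k => cc_weight n k * sin (t * cheb_point n k)) n = 0.
Proof.
  intros Hn; set (u := fun k => cc_weight n k * sin (t * cheb_point n k)).
  assert (H : sum_n u n = - sum_n u n).
  { transitivity (sum_n (fun k => mult (-1) (u k)) n).
    - rewrite <- (sum_n_rev u n) at 1. apply sum_n_ext_loc; intros k Hk. unfold u.
      rewrite cc_weight_reflect, cheb_point_reflect by assumption.
      replace (t * - cheb_point n k) with (- (t * cheb_point n k)) by ring.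
      rewrite sin_neg; change mult with Rmult; R_eq; ring.
    - rewrite (sum_n_mult_l (K := R_Ring)).
      change (-1 * (sum_n u n : R) = - (sum_n u n : R)); ring. }
  change (sum_n u n = 0 :> R). lra.
Qed.

Lemma cc_error_Cmod (N n : nat) (x : R) : (1 <= n)%nat ->
  Cmod (RtoC (sinc (INR N * PI * x)) -
             sum_n (fun k : nat =>
                      (RtoC (cc_weight n k) *
                       cexp (- RtoC PI * Ci * RtoC (INR N) *
                             RtoC (cheb_point n k) * RtoC x))%C) n)%C
  = Rabs (sinc (INR N * PI * x)
          - sum_n (fun k => cc_weight n k * cos (INR N * PI * x * cheb_point n k)) n).
Proof.
  intros Hn; rewrite <- Cmod_R; f_equal.
  set (t := INR N * PI * x).
  assert (Hterm : forall k, (RtoC (cc_weight n k) *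
                       cexp (- RtoC PI * Ci * RtoC (INR N) *
                             RtoC (cheb_point n k) * RtoC x))%C
     = (cc_weight n k * cos (t * cheb_point n k), - (cc_weight n k * sin (t * cheb_point n k)))).
  { intros k; unfold cexp.
    replace (Re (- RtoC PI * Ci * RtoC (INR N) * RtoC (cheb_point n k) * RtoC x)%C) with 0
      by (simpl; ring).
    replace (Im (- RtoC PI * Ci * RtoC (INR N) * RtoC (cheb_point n k) * RtoC x)%C)
      with (- (t * cheb_point n k)) by (unfold t; simpl; ring).
    rewrite exp_0, cos_neg, sin_neg. apply injective_projections; simpl; ring. }
  rewrite (sum_n_ext _ _ n Hterm).
  set (v := fun k => ((cc_weight n k * cos (t * cheb_point n k),
                      - (cc_weight n k * sin (t * cheb_point n k))) : C)).
  assert (HR : Re (sum_n v n) = sum_n (fun k => cc_weight n k * cos (t * cheb_point n k)) n)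
    by (rewrite Re_sum_n; reflexivity).
  assert (HI : Im (sum_n v n) = 0).
  { rewrite Im_sum_n, <- Ropp_0, <- (cc_sin_zero n t Hn).
    assert (Hopp : forall (u : nat -> R) M, sum_n (fun k => - u k) M = - sum_n u M).
    { intros u M; induction M as [|M IH]; [now rewrite !sum_O|].
      rewrite !sum_Sn, IH; change plus with Rplus; R_eq.
      generalize (sum_n u M : R); intros s; ring. }
    rewrite <- Hopp; reflexivity. }
  rewrite <- HR. destruct (sum_n v n) as [r i]; simpl in HI |- *; subst i.
  apply injective_projections; simpl; ring.
Qed.

Lemma two_cosh_threshold_error (N n : nat) (nu : R) : INR n = nu * INR N ->
  2 * cosh (INR N * threshold) * (36 / (35 * (exp 1 ^ 2 - 1)) * exp (- INR n))
  = error_bound N nu.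
Proof.
  intros Hn; unfold error_bound, cosh.
  replace (- INR N * (nu - threshold)) with (INR N * threshold + - INR n)
    by (rewrite Hn; ring).
  replace (- (INR N * threshold)) with (- 2 * threshold * INR N + INR N * threshold) by ring.
  rewrite !exp_plus.
  pose proof exp_1_bounds. field. nra.
Qed.

(** The rule with nodes 1 and -1 has both weights equal to 1/2, so the error is
    at most 2, and 2 is below the bound because N C >= 3.686. *)
Lemma error_bound_two_nodes (N : nat) (t : R) : (1 <= N)%nat ->
  Rabs (sinc t - sum_n (fun k => cc_weight 1 k * cos (t * cheb_point 1 k)) 1)
  <= 2 * cosh (INR N * threshold) * (36 / (35 * (exp 1 ^ 2 - 1)) * exp (- INR 1)).
Proof.
  intros HN; apply le_INR in HN; simpl (INR 1) in *.
  apply Rle_trans with 2.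
  - assert (Hw : forall k, k = 0%nat \/ k = 1%nat -> cc_weight 1 k = 1 / 2).
    { intros k Hk; unfold cc_weight. rewrite eps_sq_end by tauto.
      change (Nat.div 1 2) with 0%nat; rewrite sum_O, eps_sq_end by auto.
      simpl (INR 0). simpl (INR 1).
      replace (2 * 0 * INR k * PI / 1) with 0 by field. rewrite cos_0; field. }
    rewrite sum_Sn, sum_O, !Hw by auto. change plus with Rplus.
    pose proof (COS_bound (t * cheb_point 1 0)); pose proof (COS_bound (t * cheb_point 1 1)).
    assert (Hs : Rabs (sinc t) <= 1).
    { replace 1 with ((PI - 0) * (1 / PI)) by (field; apply PI_neq0).
      assert (Hs1 : is_RInt (fun th => sin th / 2) 0 PI 1).
      { pose proof (is_RInt_sinc 0) as H1. unfold sinc in H1.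
        destruct (Req_EM_T 0 0) as [_|h]; [|now destruct h].
        eapply is_RInt_ext; [|exact H1]. intros th _; simpl.
        rewrite Rmult_0_l, cos_0; R_eq; ring. }
      replace ((PI - 0) * (1 / PI)) with 1 by (field; apply PI_neq0).
      pose proof PI_RGT_0.
      apply (norm_RInt_le (V := R_NormedModule) _ _ 0 PI (sinc t) 1 ltac:(lra)) with
        (2 := is_RInt_sinc t) (3 := Hs1).
      intros th Hth. change norm with Rabs. rewrite Rabs_mult.
      pose proof (sin_ge_0 th ltac:(lra) ltac:(lra)).
      rewrite (Rabs_pos_eq (sin th / 2)) by lra.
      assert (Rabs (cos (t * cos th)) <= 1) by (apply Rabs_le, COS_bound). nra. }
    apply Rabs_le_between in Hs. apply Rabs_le; lra.
  - pose proof threshold_bounds as [c1 _]. pose proof exp_1_bounds as [e1 e2].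
    set (y := INR N * threshold).
    assert (Hy : 3.686 <= y) by (unfold y; nra).
    set (e := exp 1) in *.
    assert (Hp : exp (y - 1) >= e * e * 1.9).
    { replace (y - 1) with (1 + 1 + (y - 3)) by ring. rewrite !exp_plus. fold e.
      assert (1.9 <= exp (y - 3)).
      { eapply Rle_trans; [|apply (exp_ge_taylor (y - 3) 2); lra]. simpl.
        assert (0.686 <= y - 3) by lra. nra. }
      apply Rle_ge, Rmult_le_compat_l; [nra|assumption]. }
    assert (Hq : exp (y - 1) <= 2 * cosh y * exp (- (1))).
    { unfold cosh. replace (y - 1) with (y + - (1)) by ring. rewrite exp_plus.
      pose proof (exp_pos (- y)); pose proof (exp_pos (- (1))). nra. }
    replace (2 * cosh y * (36 / (35 * (e ^ 2 - 1)) * exp (- (1))))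
      with (36 / (35 * (e ^ 2 - 1)) * (2 * cosh y * exp (- (1)))) by (field; nra).
    apply Rle_trans with (36 / (35 * (e ^ 2 - 1)) * (e * e * 1.9)).
    + assert (0 < 35 * (e ^ 2 - 1)) by nra.
      apply Rmult_le_reg_r with (35 * (e ^ 2 - 1)); [assumption|].
      replace (36 / (35 * (e ^ 2 - 1)) * (e * e * 1.9) * (35 * (e ^ 2 - 1)))
        with (36 * (e * e * 1.9)) by (field; nra). nra.
    + apply Rmult_le_compat_l; [|lra].
      apply Rdiv_le_0_compat; [lra|nra].
Qed.

Theorem theorem5p3 :
  (forall (N n : nat) (nu : R),
     (1 <= N)%nat -> (1 <= n)%nat -> INR n = nu * INR N ->
     forall x : R, -1 <= x <= 1 ->
       Cmod (RtoC (sinc (INR N * PI * x)) -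
             sum_n (fun k : nat =>
                      (RtoC (cc_weight n k) *
                       cexp (- RtoC PI * Ci * RtoC (INR N) *
                             RtoC (cheb_point n k) * RtoC x))%C) n)%C
       <= error_bound N nu)
  /\
  (forall nu : R, threshold < nu ->
     exists K c : R, 0 < K /\ 0 < c /\
       forall N : nat, (1 <= N)%nat -> error_bound N nu <= K * exp (- c * INR N))
  /\
  Rabs (threshold - 3.69) < 0.005.
Proof.
  pose proof exp_1_bounds as He; pose proof threshold_bounds as Ht.
  assert (He2 : 0 < 35 * (exp 1 ^ 2 - 1)) by nra.
  split; [|split].
  - intros N n nu HN Hn Hnu x Hx.
    rewrite cc_error_Cmod by assumption.
    rewrite <- (two_cosh_threshold_error N n nu Hnu).
    destruct (Nat.eq_dec n 1) as [->|Hn1]; [now apply error_bound_two_nodes|].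
    eapply Rle_trans; [apply cc_error_bound; lia|].
    apply Rmult_le_compat_r.
    + apply Rmult_le_pos; [apply Rdiv_le_0_compat; lra|left; apply exp_pos].
    + apply Rmult_le_compat_l; [lra|]. apply cosh_even_mono.
      rewrite threshold_sinh.
      replace (INR N * PI * x * sinh 1) with (x * (INR N * (PI * sinh 1))) by ring.
      rewrite Rabs_mult. rewrite <- (Rmult_1_l (Rabs (INR N * (PI * sinh 1)))) at 2.
      apply Rmult_le_compat_r; [apply Rabs_pos|]. apply Rabs_le; lra.
  - intros nu Hnu; exists (72 / (35 * (exp 1 ^ 2 - 1))), (nu - threshold).
    split; [apply Rdiv_lt_0_compat; lra|]. split; [lra|].
    intros N HN; unfold error_bound.
    replace (- (nu - threshold) * INR N) with (- INR N * (nu - threshold)) by ring.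
    apply Rmult_le_compat_r; [left; apply exp_pos|].
    apply Rmult_le_compat_r; [left; now apply Rinv_0_lt_compat|].
    assert (exp (- 2 * threshold * INR N) <= exp 0); [|rewrite exp_0 in *; lra].
    left; apply exp_increasing. apply le_INR in HN; simpl (INR 1) in HN. nra.
  - apply Rabs_lt_between; lra.
Qed.
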